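(* Let $\varphi(x)=a_0+a_1x+a_2x^2$ be a quadratic polynomial with real coefficients ($a_2\neq 0$) and put $c=a_0a_2+\frac{a_1}{2}-\frac{a_1^2}{4}$. Then: (a) $c>\frac14$ implies $\sigma(C_\varphi)=\{0\}$; (b) $c=\frac14$ implies $\sigma(C_\varphi)=\overline{\mathbb{D}}$; (c) $c<\frac14$ implies $\sigma(C_\varphi)=\mathbb{C}$.
   Context: $\overline{\mathbb{D}}=\{\lambda\in\mathbb{C}:|\lambda|\le 1\}$. $\mathcal{S}(\mathbb{R})$ is the Fréchet space of (complex-valued) smooth rapidly decreasing functions on $\mathbb{R}$ (Schwartz space). For a non-constant real polynomial $\varphi$, the composition operator $C_\varphi:\mathcal{S}(\mathbb{R})\to\mathcal{S}(\mathbb{R})$, $C_\varphi f=f\circ\varphi$, is well defined, linear and continuous. For a continuous linear operator $T:X\to X$ on a Fréchet space $X$, the spectrum $\sigma(T)$ is the set of all $\lambda\in\mathbb{C}$ such that $T-\lambda I:X\to X$ does not admit a continuous linear inverse. *)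

(* Defs.v *)
From Stdlib Require Import Reals Lra Lia FunctionalExtensionality ProofIrrelevance.
From Coquelicot Require Import Coquelicot.
Open Scope R_scope.

(* [NormedModuleAux K] is the join of [ModuleSpace K] and [UniformSpace]; in
   spite of its name it carries no norm. *)
Definition continuous_linear {X : NormedModuleAux C_AbsRing} (S : X -> X) : Prop :=
  (forall x y : X, S (plus x y) = plus (S x) (S y)) /\
  (forall (l : C) (x : X), S (scal l x) = scal l (S x)) /\
  (forall x : X, continuous S x).

Definition spectrum {X : NormedModuleAux C_AbsRing} (T : X -> X) (l : C) : Prop :=
  ~ exists S : X -> X, continuous_linear S /\
      (forall x : X, S (minus (T x) (scal l x)) = x) /\
      (forall x : X, minus (T (S x)) (scal l (S x)) = x).

Definition CDerive_n (f : R -> C) (n : nat) (x : R) : C :=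
  (Derive_n (fun t => Re (f t)) n x, Derive_n (fun t => Im (f t)) n x).

Definition smooth (f : R -> C) : Prop :=
  forall (n : nat) (x : R),
    ex_derive_n (fun t => Re (f t)) n x /\ ex_derive_n (fun t => Im (f t)) n x.

Definition schwartz (f : R -> C) : Prop :=
  smooth f /\
  forall k n : nat, exists M : R, forall x : R,
    Rabs x ^ k * Cmod (CDerive_n f n x) <= M.

(* The supremum over x of |x|^k |f^(n)(x)|, which is finite when f is a
   Schwartz function: see [seminorm_ub]. *)
Definition seminorm (k n : nat) (f : R -> C) : R :=
  real (Lub_Rbar (fun r => exists x : R, r = Rabs x ^ k * Cmod (CDerive_n f n x))).

Record SchwartzSpace : Type :=
  mkSchwartz { sfun :> R -> C; sfunP : schwartz sfun }.

Lemma schwartz_ext (f g : SchwartzSpace) : (forall x, f x = g x) -> f = g.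
Proof.
  destruct f as [f hf], g as [g hg]; simpl; intros H.
  assert (E : f = g) by (apply functional_extensionality; exact H).
  subst g; f_equal; apply proof_irrelevance.
Qed.

Definition rschwartz (u : R -> R) : Prop :=
  (forall n x, ex_derive_n u n x) /\
  forall k n : nat, exists M, forall x, Rabs x ^ k * Rabs (Derive_n u n x) <= M.

Lemma Cmod_le_abs (z : C) : Cmod z <= Rabs (fst z) + Rabs (snd z).
Proof.
  unfold Cmod; apply Rsqr_incr_0_var.
  - unfold Rsqr; rewrite sqrt_sqrt by nra.
    pose proof (Rabs_pos (fst z)); pose proof (Rabs_pos (snd z)).
    rewrite <- (pow2_abs (fst z)), <- (pow2_abs (snd z)); nra.
  - pose proof (Rabs_pos (fst z)); pose proof (Rabs_pos (snd z)); lra.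
Qed.

Lemma schwartz_parts (f : R -> C) :
  schwartz f <->
  rschwartz (fun t => Re (f t)) /\ rschwartz (fun t => Im (f t)).
Proof.
  split.
  - intros [Hs Hb]; split; split; try (intros n x; apply Hs);
      intros k n; destruct (Hb k n) as [M HM]; exists M; intros x;
      eapply Rle_trans; try apply (HM x);
      apply Rmult_le_compat_l; try (apply pow_le, Rabs_pos);
      pose proof (Rmax_Cmod (CDerive_n f n x)) as Hm;
      eapply Rle_trans; try apply Hm; [apply Rmax_l | apply Rmax_r].
  - intros [[H1 B1] [H2 B2]]; split.
    + intros n x; split; [apply H1 | apply H2].
    + intros k n; destruct (B1 k n) as [M1 HM1], (B2 k n) as [M2 HM2].
      exists (M1 + M2); intros x.
      specialize (HM1 x); specialize (HM2 x).
      pose proof (Cmod_le_abs (CDerive_n f n x)) as Hc; simpl in Hc.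
      pose proof (pow_le (Rabs x) k (Rabs_pos x)); nra.
Qed.

Lemma rschwartz_ext (u v : R -> R) :
  (forall x, u x = v x) -> rschwartz u -> rschwartz v.
Proof.
  intros E; replace v with u by (apply functional_extensionality; exact E); auto.
Qed.

Lemma ex_loc (u : R -> R) n x :
  (forall k y, ex_derive_n u k y) ->
  locally x (fun y => forall k, (k <= n)%nat -> ex_derive_n u k y).
Proof. intros H; apply filter_forall; intros y k _; apply H. Qed.

Lemma rschwartz_plus (u v : R -> R) :
  rschwartz u -> rschwartz v -> rschwartz (fun x => u x + v x).
Proof.
  intros [H1 B1] [H2 B2]; split.
  - intros n x; apply ex_derive_n_plus; apply ex_loc; assumption.
  - intros k n; destruct (B1 k n) as [M1 HM1], (B2 k n) as [M2 HM2].
    exists (M1 + M2); intros x; specialize (HM1 x); specialize (HM2 x).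
    rewrite Derive_n_plus by (apply ex_loc; assumption).
    pose proof (Rabs_triang (Derive_n u n x) (Derive_n v n x)).
    pose proof (pow_le (Rabs x) k (Rabs_pos x)); nra.
Qed.

Lemma rschwartz_scal (a : R) (u : R -> R) :
  rschwartz u -> rschwartz (fun x => a * u x).
Proof.
  intros [H1 B1]; split.
  - intros n x; apply ex_derive_n_scal_l; apply H1.
  - intros k n; destruct (B1 k n) as [M1 HM1].
    exists (Rabs a * M1); intros x; specialize (HM1 x).
    rewrite Derive_n_scal_l, Rabs_mult.
    pose proof (Rabs_pos a); nra.
Qed.

Lemma schwartz_plus (f g : R -> C) :
  schwartz f -> schwartz g -> schwartz (fun x => Cplus (f x) (g x)).
Proof.
  rewrite !schwartz_parts; intros [H1 H2] [H3 H4]; split;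
    apply rschwartz_plus; assumption.
Qed.

Lemma schwartz_scal (l : C) (f : R -> C) :
  schwartz f -> schwartz (fun x => Cmult l (f x)).
Proof.
  rewrite !schwartz_parts; intros [H1 H2]; split.
  - apply rschwartz_ext with (fun x => fst l * Re (f x) + (- snd l) * Im (f x)).
    + intros x; unfold Re, Im; simpl; ring.
    + apply rschwartz_plus; apply rschwartz_scal; assumption.
  - apply rschwartz_ext with (fun x => fst l * Im (f x) + snd l * Re (f x)).
    + intros x; unfold Re, Im; simpl; ring.
    + apply rschwartz_plus; apply rschwartz_scal; assumption.
Qed.

Lemma schwartz_zero : schwartz (fun _ => RtoC 0).
Proof.
  assert (H : rschwartz (fun _ => 0)).
  { split; [intros n x; apply ex_derive_n_const|].
    intros k n; exists 0; intros x.
    replace (Derive_n (fun _ => 0) n x) with 0; [rewrite Rabs_R0; lra|].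
    destruct n; [reflexivity | rewrite Derive_n_const; reflexivity]. }
  apply schwartz_parts; split; exact H.
Qed.

Lemma schwartz_opp (f : R -> C) : schwartz f -> schwartz (fun x => Copp (f x)).
Proof.
  intros H; apply (schwartz_scal (RtoC (-1))) in H.
  replace (fun x => Copp (f x)) with (fun x => Cmult (RtoC (-1)) (f x)); [exact H|].
  apply functional_extensionality; intros x.
  unfold RtoC, Cmult, Copp; apply injective_projections; simpl; ring.
Qed.

Definition s_plus (f g : SchwartzSpace) : SchwartzSpace :=
  mkSchwartz (fun x => Cplus (f x) (g x)) (schwartz_plus f g (sfunP f) (sfunP g)).

Definition s_zero : SchwartzSpace := mkSchwartz (fun _ => RtoC 0) schwartz_zero.

Definition s_opp (f : SchwartzSpace) : SchwartzSpace :=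
  mkSchwartz (fun x => Copp (f x)) (schwartz_opp f (sfunP f)).

Definition s_scal (l : C) (f : SchwartzSpace) : SchwartzSpace :=
  mkSchwartz (fun x => Cmult l (f x)) (schwartz_scal l f (sfunP f)).

Lemma s_plus_comm f g : s_plus f g = s_plus g f.
Proof. apply schwartz_ext; intros x; apply Cplus_comm. Qed.

Lemma s_plus_assoc f g h : s_plus f (s_plus g h) = s_plus (s_plus f g) h.
Proof. apply schwartz_ext; intros x; apply Cplus_assoc. Qed.

Lemma s_plus_zero_r f : s_plus f s_zero = f.
Proof. apply schwartz_ext; intros x; apply Cplus_0_r. Qed.

Lemma s_plus_opp_r f : s_plus f (s_opp f) = s_zero.
Proof. apply schwartz_ext; intros x; apply Cplus_opp_r. Qed.

Lemma s_scal_assoc l m f : s_scal l (s_scal m f) = s_scal (Cmult l m) f.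
Proof. apply schwartz_ext; intros x; apply Cmult_assoc. Qed.

Lemma s_scal_one f : s_scal (RtoC 1) f = f.
Proof. apply schwartz_ext; intros x; apply Cmult_1_l. Qed.

Lemma s_scal_distr_l l f g : s_scal l (s_plus f g) = s_plus (s_scal l f) (s_scal l g).
Proof. apply schwartz_ext; intros x; apply Cmult_plus_distr_l. Qed.

Lemma s_scal_distr_r l m f : s_scal (Cplus l m) f = s_plus (s_scal l f) (s_scal m f).
Proof. apply schwartz_ext; intros x; apply Cmult_plus_distr_r. Qed.

Definition s_AbelianMonoid_mixin :=
  AbelianMonoid.Mixin SchwartzSpace s_plus s_zero
    s_plus_comm s_plus_assoc s_plus_zero_r.

Canonical s_AbelianMonoid :=
  AbelianMonoid.Pack SchwartzSpace s_AbelianMonoid_mixin SchwartzSpace.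

Definition s_AbelianGroup_mixin :=
  AbelianGroup.Mixin s_AbelianMonoid s_opp s_plus_opp_r.

Canonical s_AbelianGroup :=
  AbelianGroup.Pack SchwartzSpace
    (AbelianGroup.Class _ _ s_AbelianGroup_mixin) SchwartzSpace.

Definition s_ModuleSpace_mixin :=
  ModuleSpace.Mixin C_Ring s_AbelianGroup s_scal
    s_scal_assoc s_scal_one s_scal_distr_l s_scal_distr_r.

Canonical s_ModuleSpace :=
  ModuleSpace.Pack C_Ring SchwartzSpace
    (ModuleSpace.Class _ _ _ s_ModuleSpace_mixin) SchwartzSpace.

Lemma seminorm_lub (k n : nat) (f : R -> C) : schwartz f ->
  is_lub (fun r => exists x : R, r = Rabs x ^ k * Cmod (CDerive_n f n x))
         (seminorm k n f).
Proof.
  intros [_ Hb]; destruct (Hb k n) as [M HM]; unfold seminorm.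
  set (E := fun r => exists x : R, r = Rabs x ^ k * Cmod (CDerive_n f n x)).
  destruct (completeness E) as [l Hl].
  - exists M; intros r [x ->]; apply HM.
  - exists (Rabs 0 ^ k * Cmod (CDerive_n f n 0)); exists 0; reflexivity.
  - rewrite (is_lub_Rbar_unique E (Finite l)); [exact Hl|].
    split.
    + intros r Hr; apply Hl, Hr.
    + intros [b| |] Hub; simpl.
      * apply Hl; intros r Hr; apply (Hub r Hr).
      * exact I.
      * apply (Hub (Rabs 0 ^ k * Cmod (CDerive_n f n 0))); exists 0; reflexivity.
Qed.

Lemma seminorm_ub (k n : nat) (f : R -> C) : schwartz f ->
  forall x, Rabs x ^ k * Cmod (CDerive_n f n x) <= seminorm k n f.
Proof. intros Hf x; apply (seminorm_lub k n f Hf); exists x; reflexivity. Qed.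

Lemma seminorm_le (k n : nat) (f : R -> C) (M : R) : schwartz f ->
  (forall x, Rabs x ^ k * Cmod (CDerive_n f n x) <= M) -> seminorm k n f <= M.
Proof. intros Hf H; apply (seminorm_lub k n f Hf); intros r [x ->]; apply H. Qed.

Lemma seminorm_ge0 (k n : nat) (f : R -> C) : schwartz f -> 0 <= seminorm k n f.
Proof.
  intros Hf; eapply Rle_trans; [|apply (seminorm_ub k n f Hf 0)].
  apply Rmult_le_pos; [apply pow_le, Rabs_pos | apply Cmod_ge_0].
Qed.

Lemma CDerive_n_plus (f g : R -> C) (n : nat) (x : R) :
  schwartz f -> schwartz g ->
  CDerive_n (fun t => Cplus (f t) (g t)) n x =
  Cplus (CDerive_n f n x) (CDerive_n g n x).
Proof.
  rewrite !schwartz_parts; intros [[H1 _] [H2 _]] [[H3 _] [H4 _]].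
  unfold CDerive_n, Cplus; simpl; f_equal;
    rewrite <- Derive_n_plus by (apply ex_loc; assumption); reflexivity.
Qed.

Lemma CDerive_n_opp (f : R -> C) (n : nat) (x : R) :
  CDerive_n (fun t => Copp (f t)) n x = Copp (CDerive_n f n x).
Proof.
  unfold CDerive_n, Copp; simpl; f_equal; rewrite <- Derive_n_opp; reflexivity.
Qed.

Lemma seminorm_plus (k n : nat) (f g : SchwartzSpace) :
  seminorm k n (plus f g) <= seminorm k n f + seminorm k n g.
Proof.
  apply seminorm_le; [apply sfunP|]; intros x; simpl.
  rewrite CDerive_n_plus by apply sfunP.
  pose proof (Cmod_triangle (CDerive_n f n x) (CDerive_n g n x)).
  pose proof (seminorm_ub k n f (sfunP f) x).
  pose proof (seminorm_ub k n g (sfunP g) x).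
  pose proof (pow_le (Rabs x) k (Rabs_pos x)); nra.
Qed.

Lemma seminorm_opp (k n : nat) (f : SchwartzSpace) :
  seminorm k n (opp f) = seminorm k n f.
Proof.
  unfold seminorm; f_equal; apply Lub_Rbar_eqset; intros r; simpl.
  split; intros [x ->]; exists x; rewrite CDerive_n_opp, Cmod_opp; reflexivity.
Qed.

Lemma seminorm_zero (k n : nat) : seminorm k n (zero : SchwartzSpace) = 0.
Proof.
  apply Rle_antisym; [|apply seminorm_ge0, sfunP].
  apply seminorm_le; [apply sfunP|]; intros x.
  replace (CDerive_n (zero : SchwartzSpace) n x) with (RtoC 0).
  - rewrite Cmod_0; lra.
  - unfold CDerive_n; simpl.
    destruct n; [reflexivity | rewrite Derive_n_const; reflexivity].
Qed.

(* The balls of the translation invariant metric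
   sup_{k,n} min(2^-(k+n), seminorm k n (g - f)), which induces the topology
   generated by the seminorms: for e > 0, only the finitely many (k,n) with
   e <= 2^-(k+n) constrain g. *)
Definition s_ball (f : SchwartzSpace) (e : R) (g : SchwartzSpace) : Prop :=
  forall k n : nat, Rmin (/ 2 ^ (k + n)) (seminorm k n (minus g f)) < e.

Lemma s_ball_center (f : SchwartzSpace) (e : posreal) : s_ball f e f.
Proof.
  intros k n; rewrite minus_eq_zero, seminorm_zero.
  eapply Rle_lt_trans; [apply Rmin_r | apply cond_pos].
Qed.

Lemma s_ball_sym (f g : SchwartzSpace) (e : R) : s_ball f e g -> s_ball g e f.
Proof.
  intros H k n; specialize (H k n).
  rewrite <- (opp_minus g f), seminorm_opp; exact H.
Qed.

Lemma s_ball_triangle (f g h : SchwartzSpace) (e1 e2 : R) :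
  s_ball f e1 g -> s_ball g e2 h -> s_ball f (e1 + e2) h.
Proof.
  intros H1 H2 k n; specialize (H1 k n); specialize (H2 k n).
  assert (T : seminorm k n (minus h f) <=
    seminorm k n (minus h g) + seminorm k n (minus g f)).
  { rewrite (minus_trans g h f); apply seminorm_plus. }
  pose proof (seminorm_ge0 k n _ (sfunP (minus h g))) as P1.
  pose proof (seminorm_ge0 k n _ (sfunP (minus g f))) as P2.
  assert (P : 0 < / 2 ^ (k + n)) by (apply Rinv_0_lt_compat, pow_lt; lra).
  revert H1 H2; unfold Rmin; repeat destruct Rle_dec; lra.
Qed.

Definition s_UniformSpace_mixin :=
  UniformSpace.Mixin SchwartzSpace s_zero s_ball
    s_ball_center s_ball_sym s_ball_triangle.

Canonical s_UniformSpace :=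
  UniformSpace.Pack SchwartzSpace s_UniformSpace_mixin SchwartzSpace.

Canonical s_NormedModuleAux :=
  NormedModuleAux.Pack C_AbsRing SchwartzSpace
    (NormedModuleAux.Class C_AbsRing _
       (ModuleSpace.Class C_Ring _ _ s_ModuleSpace_mixin)
       s_UniformSpace_mixin) SchwartzSpace.

Definition symbol (phi : R -> R) : Prop :=
  forall f : R -> C, schwartz f -> schwartz (fun x => f (phi x)).

Definition comp_op (phi : R -> R) (hphi : symbol phi) (f : SchwartzSpace) :
    SchwartzSpace :=
  mkSchwartz (fun x => f (phi x)) (hphi f (sfunP f)).

Definition quadratic (a0 a1 a2 x : R) : R := a0 + a1 * x + a2 * x ^ 2.

(* Contains u o phi for every real Schwartz function u and is stable under
   differentiation, where phi = quadratic a0 a1 a2. *)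
Inductive pullback (a0 a1 a2 : R) : (R -> R) -> Prop :=
| pb_base (m : nat) (u : R -> R) : rschwartz u ->
    pullback a0 a1 a2 (fun x => x ^ m * u (quadratic a0 a1 a2 x))
| pb_plus g h : pullback a0 a1 a2 g -> pullback a0 a1 a2 h ->
    pullback a0 a1 a2 (fun x => g x + h x)
| pb_scal c g : pullback a0 a1 a2 g -> pullback a0 a1 a2 (fun x => c * g x).

Lemma rschwartz_Derive (u : R -> R) : rschwartz u -> rschwartz (Derive u).
Proof.
  intros [H B].
  assert (E : forall n x, Derive_n (Derive u) n x = Derive_n u (S n) x).
  { intros n x; change (Derive u) with (Derive_n u 1).
    rewrite Derive_n_comp; f_equal; lia. }
  split.
  - intros [|n] x; [exact I|]; simpl.
    apply ex_derive_ext with (Derive_n u (S n)); [intros t; symmetry; apply E|].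
    apply (H (S (S n)) x).
  - intros k n; destruct (B k (S n)) as [M HM]; exists M; intros x.
    rewrite E; apply HM.
Qed.

Lemma pullback_derive a0 a1 a2 g : pullback a0 a1 a2 g ->
  exists g', pullback a0 a1 a2 g' /\ forall x, is_derive g x (g' x).
Proof.
  induction 1 as [m u Hu | g h _ [g' [Hg Dg]] _ [h' [Hh Dh]] | c g _ [g' [Hg Dg]]].
  - pose proof (rschwartz_Derive u Hu) as Hu'.
    set (phi := quadratic a0 a1 a2).
    exists (fun x => INR m * (x ^ pred m * u (phi x)) +
      (a1 * (x ^ m * Derive u (phi x)) + (2 * a2) * (x ^ S m * Derive u (phi x)))).
    split.
    + apply pb_plus; [|apply pb_plus]; apply pb_scal.
      * exact (pb_base a0 a1 a2 _ _ Hu).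
      * exact (pb_base a0 a1 a2 _ _ Hu').
      * exact (pb_base a0 a1 a2 _ _ Hu').
    + intros x.
      assert (Eu : ex_derive u (phi x)) by exact (proj1 Hu 1%nat (phi x)).
      unfold phi, quadratic in *; auto_derive.
      * replace (a0 + a1 * x + a2 * (x * x)) with (a0 + a1 * x + a2 * x ^ 2)
          by ring.
        exact Eu.
      * replace (a0 + a1 * x + a2 * (x * x)) with (a0 + a1 * x + a2 * x ^ 2)
          by ring.
        change (Derive (fun x0 => u x0)) with (Derive u).
        simpl; ring.
  - exists (fun x => g' x + h' x); split; [apply pb_plus; assumption|].
    intros x; exact (is_derive_plus g h x (g' x) (h' x) (Dg x) (Dh x)).
  - exists (fun x => c * g' x); split; [apply pb_scal; assumption|].
    intros x; exact (is_derive_scal g x c (g' x) (Dg x)).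
Qed.

Lemma pullback_Derive_n a0 a1 a2 g n : pullback a0 a1 a2 g ->
  exists gn, pullback a0 a1 a2 gn /\ forall x, Derive_n g n x = gn x.
Proof.
  intros Hg; induction n as [|n [gn [Hn En]]]; [exists g; auto|].
  destruct (pullback_derive _ _ _ _ Hn) as [g' [Hg' Dg']].
  exists g'; split; [exact Hg'|]; intros x; simpl.
  rewrite (Derive_ext _ gn) by exact En; apply is_derive_unique, Dg'.
Qed.

Lemma quadratic_lower a0 a1 a2 x : a2 <> 0 ->
  Rabs x <= (1 + (1 + Rabs a0 + Rabs a1) / Rabs a2) *
            (1 + Rabs (quadratic a0 a1 a2 x)).
Proof.
  intros Ha.
  assert (P : 0 < Rabs a2) by (apply Rabs_pos_lt, Ha).
  pose proof (Rabs_pos a0) as P0; pose proof (Rabs_pos a1) as P1.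
  set (q := Rabs (quadratic a0 a1 a2 x)).
  assert (Hq : 0 <= q) by apply Rabs_pos.
  set (d := (1 + Rabs a0 + Rabs a1) / Rabs a2).
  assert (Hd : d * Rabs a2 = 1 + Rabs a0 + Rabs a1) by (unfold d; field; lra).
  assert (d > 0) by (apply Rdiv_lt_0_compat; lra).
  destruct (Rle_dec (Rabs x) 1) as [Hx|Hx]; [nra|].
  assert (K : Rabs a2 * (Rabs x * Rabs x) <= q + Rabs a0 + Rabs a1 * Rabs x).
  { rewrite <- !Rabs_mult.
    replace (a2 * (x * x)) with (quadratic a0 a1 a2 x + (- a0 + - (a1 * x)))
      by (unfold quadratic; ring).
    eapply Rle_trans; [apply Rabs_triang|].
    pose proof (Rabs_triang (- a0) (- (a1 * x))) as T; rewrite !Rabs_Ropp in T.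
    fold q; lra. }
  assert (Rabs a2 * Rabs x <= q + Rabs a0 + Rabs a1).
  { apply Rmult_le_reg_r with (Rabs x); [lra|]; nra. }
  assert (Rabs a2 * Rabs x <= Rabs a2 * (d * (1 + q))) by nra.
  assert (Rabs x <= d * (1 + q)) by (apply Rmult_le_reg_l with (Rabs a2); lra).
  nra.
Qed.

Lemma pow_1_plus (y : R) (j : nat) : 0 <= y -> (1 + y) ^ j <= 2 ^ j * (1 + y ^ j).
Proof.
  intros Hy; pose proof (pow_le y j Hy).
  assert (0 < 2 ^ j) by (apply pow_lt; lra).
  destruct (Rle_dec y 1).
  - apply Rle_trans with (2 ^ j); [apply pow_incr; lra | nra].
  - apply Rle_trans with ((2 * y) ^ j); [apply pow_incr; lra|].
    rewrite Rpow_mult_distr; nra.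
Qed.

Lemma pullback_decay a0 a1 a2 g : a2 <> 0 -> pullback a0 a1 a2 g ->
  forall k, exists M, forall x, Rabs x ^ k * Rabs (g x) <= M.
Proof.
  intros Ha.
  induction 1 as [m u [_ B] | g h _ IHg _ IHh | c g _ IHg]; intros k.
  - set (K := 1 + (1 + Rabs a0 + Rabs a1) / Rabs a2).
    destruct (B 0%nat 0%nat) as [M0 H0], (B (k + m)%nat 0%nat) as [M1 H1].
    assert (HK : 0 <= K).
    { pose proof (Rabs_pos a0); pose proof (Rabs_pos a1).
      assert (0 < Rabs a2) by (apply Rabs_pos_lt, Ha).
      assert (0 < (1 + Rabs a0 + Rabs a1) / Rabs a2)
        by (apply Rdiv_lt_0_compat; lra).
      unfold K; lra. }
    set (D := K ^ (k + m) * 2 ^ (k + m)).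
    assert (HD : 0 <= D) by (apply Rmult_le_pos; apply pow_le; lra).
    exists (D * (M0 + M1)); intros x.
    set (y := quadratic a0 a1 a2 x).
    specialize (H0 y); specialize (H1 y); simpl in H0, H1.
    rewrite Rabs_mult, <- RPow_abs, <- Rmult_assoc, <- pow_add.
    assert (Hx : Rabs x ^ (k + m) <= D * (1 + Rabs y ^ (k + m))).
    { eapply Rle_trans;
        [apply pow_incr; split; [apply Rabs_pos | apply quadratic_lower, Ha]|].
      fold K y; rewrite Rpow_mult_distr; unfold D; rewrite Rmult_assoc.
      apply Rmult_le_compat_l; [apply pow_le; lra|].
      apply pow_1_plus, Rabs_pos. }
    apply Rle_trans with (D * (1 + Rabs y ^ (k + m)) * Rabs (u y)).
    + apply Rmult_le_compat_r; [apply Rabs_pos | exact Hx].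
    + rewrite Rmult_assoc; apply Rmult_le_compat_l; [exact HD|]; lra.
  - destruct (IHg k) as [M1 H1], (IHh k) as [M2 H2].
    exists (M1 + M2); intros x; specialize (H1 x); specialize (H2 x).
    pose proof (Rabs_triang (g x) (h x)).
    pose proof (pow_le (Rabs x) k (Rabs_pos x)); nra.
  - destruct (IHg k) as [M1 H1].
    exists (Rabs c * M1); intros x; specialize (H1 x).
    rewrite Rabs_mult; pose proof (Rabs_pos c); nra.
Qed.

Lemma rschwartz_quadratic a0 a1 a2 u : a2 <> 0 -> rschwartz u ->
  rschwartz (fun x => u (quadratic a0 a1 a2 x)).
Proof.
  intros Ha Hu.
  assert (P : pullback a0 a1 a2 (fun x => u (quadratic a0 a1 a2 x))).
  { replace (fun x => u (quadratic a0 a1 a2 x))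
      with (fun x => x ^ 0 * u (quadratic a0 a1 a2 x)); [apply pb_base, Hu|].
    apply functional_extensionality; intros x; simpl; ring. }
  split.
  - intros [|n] x; [exact I|]; simpl.
    destruct (pullback_Derive_n _ _ _ _ n P) as [gn [Hn En]].
    destruct (pullback_derive _ _ _ _ Hn) as [g' [_ Dg']].
    apply ex_derive_ext with gn; [intros t; symmetry; apply En|].
    exists (g' x); apply Dg'.
  - intros k n; destruct (pullback_Derive_n _ _ _ _ n P) as [gn [Hn En]].
    destruct (pullback_decay _ _ _ _ Ha Hn k) as [M HM].
    exists M; intros x; rewrite En; apply HM.
Qed.

Lemma quadratic_symbol (a0 a1 a2 : R) (ha2 : a2 <> 0) :
  symbol (quadratic a0 a1 a2).
Proof.
  intros f; rewrite !schwartz_parts; intros [H1 H2]; split.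
  - exact (rschwartz_quadratic a0 a1 a2 (fun t => Re (f t)) ha2 H1).
  - exact (rschwartz_quadratic a0 a1 a2 (fun t => Im (f t)) ha2 H2).
Qed.

(* Main.v *)
Require Import Defs.
From Stdlib Require Import Reals Lra Lia FunctionalExtensionality ClassicalEpsilon.
From Coquelicot Require Import Coquelicot.
Open Scope R_scope.

(** Completing the square conjugates the operator to composition with
    psi(x) = x^2 + c by an affine change of variable, which does not affect the
    spectrum ([spectrum_conj], [centred_conjugacy]).  Everything depends on the
    fixed points of psi on the real line: none for c > 1/4, the single parabolic
    point 1/2 for c = 1/4, and for c < 1/4 two points, the larger of which has
    multiplier th = 1 + sqrt (1 - 4 c) > 1.

    Upper bounds.  Let T be the composition operator.  For l <> 0 the inverse of
    T - l should be the Neumann series - sum_j l^-(j+1) T^j, and it is, provided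
    every seminorm of T^j g is at most M r^j times finitely many seminorms of g
    for some r < |l| ([powers_bounded_not_spectrum]).  Such estimates come from
    one step only.  The n-th derivative of u o psi is (psi')^n (u^(n) o psi) plus
    terms in lower derivatives of u at psi(x).  Hence the jet of order n, measured
    with u^(i) multiplied by eta^i for a small eta, is expanded at x by a factor
    of at most (1 + eps) max (1, |psi'(x)|)^n ([jet_comp_quadratic]).  If a weight
    W absorbs this factor, that is max (1, |psi'|)^n W <= r0 (W o psi), then
    in the weighted sup norm T has norm at most about r0
    ([weighted_jets_contract]).  Without fixed points every orbit escapes and a
    high power of 1 + |x| is such a weight for arbitrarily small r0
    ([weight_no_fixed_point]), so only l = 0 can be spectral.  In the parabolic
    case a power of eps / 2 + (|x| - 1/2)^+ gives every r0 > 1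
    ([weight_parabolic]), so the spectrum lies in the closed disc.

    Lower bounds.  T is never surjective, because its image consists of functions
    symmetric about the vertex of the parabola ([zero_in_spectrum]).  For c <= 1/4
    and l <> 0, move the larger fixed point to 0, so that the map becomes
    chi(x) = th x + x^2, and consider f o chi - l f = g
    ([repelling_spectrum]).  If l is a power th^i, take i minimal: comparing jets
    at 0, the order-i coefficient on the left vanishes as soon as those of g of
    lower order do, so g = x^i + ... is not in the image.  Otherwise take for g a
    bump at 1.  Along the forward orbit of 1 rapid decay forces f = 0, so
    f(1) <> 0; along the backward orbit y_n, which tends to 0, one has
    f(1) = l^n f(y_n), while all derivatives of f at 0 vanish up to an order m
    of one's choice, so that |f(1)| <= M |l|^n y_n^m.  For th > 1 the orbit decays
    geometrically and a large m gives a contradiction for any l; for th = 1 it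
    tends to 0 and m = 1 gives one whenever |l| <= 1. *)

(** * Continuity from seminorm estimates *)

(** All seminorms of index at most K at once, phrased pointwise so that no
    supremum has to be handled in the estimates. *)
Definition seminorms_le (K : nat) (B : R) (f : R -> C) : Prop :=
  forall i j x, (i <= K)%nat -> (j <= K)%nat ->
    Rabs x ^ i * Cmod (CDerive_n f j x) <= B.

Definition seminorm_bounded (S : SchwartzSpace -> SchwartzSpace) : Prop :=
  forall k n : nat, exists (K : nat) (M : R), forall (f : SchwartzSpace) (B : R),
    seminorms_le K B f ->
    forall x, Rabs x ^ k * Cmod (CDerive_n (S f) n x) <= M * B.

Lemma s_ball_weaken (f g : SchwartzSpace) (d e : R) :
  d <= e -> s_ball f d g -> s_ball f e g.
Proof. intros H B k n; specialize (B k n); lra. Qed.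

(** The truncation by 2^-(i+j) in the metric is inactive on the indices i, j <= K
    once the radius is at most 2^-2K. *)
Lemma s_ball_seminorms_le (K : nat) (d : R) (f g : SchwartzSpace) :
  d <= / 2 ^ (K + K) -> s_ball f d g -> seminorms_le K d (minus g f).
Proof.
  intros Hd H i j x Hi Hj.
  apply Rle_trans with (seminorm i j (minus g f)).
  - apply (seminorm_ub i j _ (sfunP (minus g f))).
  - specialize (H i j).
    assert (/ 2 ^ (K + K) <= / 2 ^ (i + j)).
    { apply Rinv_le_contravar; [apply pow_lt; lra|].
      apply Rle_pow; [lra | lia]. }
    revert H; unfold Rmin; destruct Rle_dec; lra.
Qed.

Lemma finite_min (Q : nat -> R -> Prop) :
  (forall i d d', 0 < d' <= d -> Q i d -> Q i d') ->
  (forall i, exists d, 0 < d /\ Q i d) ->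
  forall N, exists d, 0 < d /\ forall i, (i <= N)%nat -> Q i d.
Proof.
  intros Hm HQ N; induction N as [|N [d [Hd IH]]].
  - destruct (HQ 0%nat) as [d [Hd H]]; exists d; split; [exact Hd|].
    intros i Hi; replace i with 0%nat by lia; exact H.
  - destruct (HQ (S N)) as [d' [Hd' H]]; exists (Rmin d d'); split.
    + apply Rmin_pos; assumption.
    + intros i Hi; destruct (Nat.eq_dec i (S N)) as [->|Hn].
      * apply Hm with d'; [|exact H].
        split; [apply Rmin_pos; assumption | apply Rmin_r].
      * apply Hm with d; [|apply IH; lia].
        split; [apply Rmin_pos; assumption | apply Rmin_l].
Qed.

Lemma additive_minus (S : SchwartzSpace -> SchwartzSpace) :
  (forall f g, S (plus f g) = plus (S f) (S g)) ->
  forall f g, S (minus f g) = minus (S f) (S g).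
Proof.
  intros HS f g.
  assert (E : S f = plus (S (minus f g)) (S g)).
  { rewrite <- HS; f_equal; apply schwartz_ext; intros x; simpl; ring. }
  rewrite E; apply schwartz_ext; intros x; simpl; ring.
Qed.

(** By additivity it is enough to control S (g - f); the metric sees only finitely
    many seminorms at a given precision, and each of them is dominated by finitely
    many seminorms of g - f. *)
Lemma seminorm_bounded_continuous (S : SchwartzSpace -> SchwartzSpace) :
  (forall f g, S (plus f g) = plus (S f) (S g)) ->
  seminorm_bounded S -> forall f, continuous S f.
Proof.
  intros Hadd Hb f.
  assert (H1 : forall e, 0 < e -> forall k n, exists d, 0 < d /\
    forall g, s_ball f d g -> seminorm k n (minus (S g) (S f)) < e).
  { intros e He k n; destruct (Hb k n) as [K [M HM]].
    pose proof (Rabs_pos M) as HM0; pose proof (Rle_abs M) as HM1.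
    set (d := Rmin (/ 2 ^ (K + K)) (e / (2 * (Rabs M + 1)))).
    assert (Hd2 : d <= e / (2 * (Rabs M + 1))) by apply Rmin_r.
    assert (Hd1 : d <= / 2 ^ (K + K)) by apply Rmin_l.
    assert (Hd : 0 < d).
    { apply Rmin_pos; [apply Rinv_0_lt_compat, pow_lt; lra|].
      apply Rdiv_lt_0_compat; lra. }
    exists d; split; [exact Hd|]; intros g Hg.
    apply Rle_lt_trans with (M * d).
    - apply seminorm_le; [apply sfunP|].
      rewrite <- (additive_minus S Hadd).
      apply HM, s_ball_seminorms_le; assumption.
    - apply Rle_lt_trans with (Rabs M * (e / (2 * (Rabs M + 1)))); [nra|].
      replace (Rabs M * (e / (2 * (Rabs M + 1))))
        with (e * (Rabs M / (2 * (Rabs M + 1)))) by (field; lra).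
      assert (Rabs M / (2 * (Rabs M + 1)) < 1).
      { apply Rmult_lt_reg_r with (2 * (Rabs M + 1)); [lra|].
        unfold Rdiv; rewrite Rmult_assoc, Rinv_l; lra. }
      nra. }
  assert (H2 : forall e, 0 < e -> forall N, exists d, 0 < d /\ forall k n,
    (k <= N)%nat -> (n <= N)%nat ->
    forall g, s_ball f d g -> seminorm k n (minus (S g) (S f)) < e).
  { intros e He N.
    destruct (finite_min (fun k d => forall n, (n <= N)%nat ->
      forall g, s_ball f d g -> seminorm k n (minus (S g) (S f)) < e)) with N
      as [d [Hd H]].
    - intros k d d' Hd H n Hn g Hg; apply H; [exact Hn|].
      apply s_ball_weaken with d'; [lra | exact Hg].
    - intros k.
      destruct (finite_min (fun n d => 
        forall g, s_ball f d g -> seminorm k n (minus (S g) (S f)) < e)) with N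
        as [d [Hd H]].
      + intros n d d' Hd H g Hg; apply H.
        apply s_ball_weaken with d'; [lra | exact Hg].
      + intros n; apply H1, He.
      + exists d; split; [exact Hd | exact H].
    - exists d; split; [exact Hd|]; intros k n Hk Hn; apply H; assumption. }
  intros P [e HP].
  destruct (pow_lt_1_zero (/ 2)) with (y := pos e) as [N HN].
  { rewrite Rabs_pos_eq; lra. }
  { apply cond_pos. }
  destruct (H2 e (cond_pos e) N) as [d [Hd H]].
  exists (mkposreal d Hd); intros g Hg; apply HP; intros k n.
  destruct (Compare_dec.le_dec (k + n) N) as [Hkn|Hkn].
  - eapply Rle_lt_trans; [apply Rmin_r|]; apply H; [lia | lia | exact Hg].
  - eapply Rle_lt_trans; [apply Rmin_l|].
    rewrite <- pow_inv; eapply Rle_lt_trans; [apply Rle_abs|]; apply HN; lia.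
Qed.

(** * Affine changes of variable *)

Lemma Derive_n_comp_affine (a b : R) (u : R -> R) (n : nat) (x : R) :
  (forall k y, ex_derive_n u k y) ->
  Derive_n (fun t => u (a * t + b)) n x = a ^ n * Derive_n u n (a * x + b).
Proof.
  intros Hu.
  rewrite (Derive_n_comp_scal (fun y => u (y + b)) a n x).
  - rewrite Derive_n_comp_trans; reflexivity.
  - apply ex_loc; intros k y; apply ex_derive_n_comp_trans, Hu.
Qed.

Lemma affine_lower (a b : R) (k : nat) : a <> 0 -> exists D, 0 <= D /\
  forall x, Rabs x ^ k <= D * (1 + Rabs (a * x + b) ^ k).
Proof.
  intros Ha; assert (P : 0 < Rabs a) by (apply Rabs_pos_lt, Ha).
  pose proof (Rabs_pos b).
  set (d := (1 + Rabs b) / Rabs a).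
  assert (Hd : d * Rabs a = 1 + Rabs b) by (unfold d; field; lra).
  assert (0 < d) by (apply Rdiv_lt_0_compat; lra).
  exists (d ^ k * 2 ^ k); split; [apply Rmult_le_pos; apply pow_le; lra|].
  intros x; set (y := a * x + b).
  assert (Hx : Rabs x <= d * (1 + Rabs y)).
  { pose proof (Rabs_triang y (- b)) as T; rewrite Rabs_Ropp in T.
    replace (y + - b) with (a * x) in T by (unfold y; ring).
    rewrite Rabs_mult in T; pose proof (Rabs_pos y).
    apply Rmult_le_reg_l with (Rabs a); [exact P|]; nra. }
  apply Rle_trans with ((d * (1 + Rabs y)) ^ k).
  - apply pow_incr; split; [apply Rabs_pos | exact Hx].
  - rewrite Rpow_mult_distr, Rmult_assoc.
    apply Rmult_le_compat_l; [apply pow_le; lra | apply pow_1_plus, Rabs_pos].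
Qed.

Lemma affine_symbol (a b : R) : a <> 0 -> symbol (fun x => a * x + b).
Proof.
  intros Ha.
  assert (H : forall u, rschwartz u -> rschwartz (fun x => u (a * x + b))).
  { intros u [H B]; split.
    - intros n x.
      apply (ex_derive_n_comp_scal (fun y => u (y + b)) a n x), ex_loc.
      intros k y; apply ex_derive_n_comp_trans, H.
    - intros k n; destruct (affine_lower a b k Ha) as [D [HD Hx]].
      destruct (B k n) as [M1 H1], (B 0%nat n) as [M2 H2].
      exists (Rabs a ^ n * (D * (M1 + M2))); intros x.
      rewrite (Derive_n_comp_affine a b u n x H), Rabs_mult, <- RPow_abs.
      specialize (H1 (a * x + b)); specialize (H2 (a * x + b)); simpl in H2.
      specialize (Hx x).
      pose proof (pow_le _ n (Rabs_pos a)).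
      pose proof (Rabs_pos (Derive_n u n (a * x + b))) as P.
      rewrite (Rmult_comm (Rabs x ^ k)), Rmult_assoc.
      apply Rmult_le_compat_l; [assumption|].
      apply Rle_trans with (Rabs (Derive_n u n (a * x + b)) *
        (D * (1 + Rabs (a * x + b) ^ k))).
      + apply Rmult_le_compat_l; assumption.
      + replace (Rabs (Derive_n u n (a * x + b)) *
        (D * (1 + Rabs (a * x + b) ^ k))) with
          (D * (Rabs (a * x + b) ^ k * Rabs (Derive_n u n (a * x + b)) +
           1 * Rabs (Derive_n u n (a * x + b)))) by ring.
        apply Rmult_le_compat_l; lra. }
  intros f; rewrite !schwartz_parts; intros [H1 H2]; split.
  - apply (H (fun t => Re (f t))), H1.
  - apply (H (fun t => Im (f t))), H2.
Qed.

Lemma Cmod_scal_pair (r p q : R) : Cmod (r * p, r * q) = Rabs r * Cmod (p, q).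
Proof.
  rewrite <- Cmod_R, <- Cmod_mult; f_equal.
  unfold RtoC, Cmult; simpl; f_equal; ring.
Qed.

Lemma affine_bounded (a b : R) (ha : a <> 0) :
  seminorm_bounded (comp_op (fun x => a * x + b) (affine_symbol a b ha)).
Proof.
  intros k n; destruct (affine_lower a b k ha) as [D [HD Hx]].
  exists (max k n), (Rabs a ^ n * (D * 2)); intros f B HB x; simpl.
  destruct (proj1 (schwartz_parts f) (sfunP f)) as [[H1 _] [H2 _]].
  unfold CDerive_n.
  rewrite (Derive_n_comp_affine a b (fun t => Re (f t)) n x H1).
  rewrite (Derive_n_comp_affine a b (fun t => Im (f t)) n x H2).
  rewrite Cmod_scal_pair, <- RPow_abs.
  specialize (Hx x); set (y := a * x + b) in *.
  pose proof (HB k n y ltac:(lia) ltac:(lia)) as B1.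
  pose proof (HB 0%nat n y ltac:(lia) ltac:(lia)) as B2.
  unfold CDerive_n in B1, B2; simpl in B2.
  set (z := Cmod _) in *.
  pose proof (Cmod_ge_0 (Derive_n (fun t => Re (f t)) n y,
    Derive_n (fun t => Im (f t)) n y)) as P; fold z in P.
  pose proof (pow_le _ n (Rabs_pos a)).
  apply Rle_trans with (Rabs a ^ n * (D * ((1 + Rabs y ^ k) * z))).
  - replace (Rabs x ^ k * (Rabs a ^ n * z)) with (Rabs a ^ n * (Rabs x ^ k * z))
      by ring.
    apply Rmult_le_compat_l; [assumption|]; nra.
  - rewrite Rmult_assoc; apply Rmult_le_compat_l; [assumption|].
    rewrite Rmult_assoc; apply Rmult_le_compat_l; [assumption|]; lra.
Qed.

(** Composition with x |-> a x + b is a bicontinuous automorphism A with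
    C_phi A = A C_psi, so an inverse of C_psi - l is carried to A S A^-1. *)
Lemma spectrum_conj (phi psi : R -> R) (hphi : symbol phi) (hpsi : symbol psi)
    (a b : R) : a <> 0 ->
  (forall x, a * phi x + b = psi (a * x + b)) ->
  forall l, spectrum (comp_op phi hphi) l -> spectrum (comp_op psi hpsi) l.
Proof.
  intros Ha E l Hs [S [[Sp [Ss Sc]] [SL SR]]]; apply Hs; clear Hs.
  assert (Ha' : / a <> 0) by (apply Rinv_neq_0_compat, Ha).
  set (A := comp_op (fun x => a * x + b) (affine_symbol a b Ha)).
  set (A' := comp_op (fun x => / a * x + - b / a)
    (affine_symbol (/ a) (- b / a) Ha')).
  assert (AA' : forall f, A (A' f) = f).
  { intros f; apply schwartz_ext; intros x; simpl; f_equal; field; exact Ha. }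
  assert (A'A : forall f, A' (A f) = f).
  { intros f; apply schwartz_ext; intros x; simpl; f_equal; field; exact Ha. }
  assert (TA : forall f, comp_op phi hphi (A f) = A (comp_op psi hpsi f)).
  { intros f; apply schwartz_ext; intros x; simpl; f_equal; apply E. }
  assert (Ap : forall f g, A (plus f g) = plus (A f) (A g))
    by (intros; apply schwartz_ext; reflexivity).
  assert (A'p : forall f g, A' (plus f g) = plus (A' f) (A' g))
    by (intros; apply schwartz_ext; reflexivity).
  assert (As : forall c f, A (scal c f) = scal c (A f))
    by (intros; apply schwartz_ext; reflexivity).
  assert (A's : forall c f, A' (scal c f) = scal c (A' f))
    by (intros; apply schwartz_ext; reflexivity).
  exists (fun f => A (S (A' f))); split; [split; [|split]|split].
  - intros f g; rewrite A'p, Sp, Ap; reflexivity.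
  - intros c f; rewrite A's, Ss, As; reflexivity.
  - intros f; apply (continuous_comp A' (fun g => A (S g))).
    + apply seminorm_bounded_continuous; [exact A'p | apply affine_bounded].
    + apply (continuous_comp S A); [apply Sc|].
      apply seminorm_bounded_continuous; [exact Ap | apply affine_bounded].
  - intros f.
    assert (F : A' (minus (comp_op phi hphi f) (scal l f)) =
      minus (comp_op psi hpsi (A' f)) (scal l (A' f))).
    { rewrite <- (A'A (comp_op psi hpsi (A' f))), <- TA, AA'.
      apply schwartz_ext; reflexivity. }
    transitivity (A (S (minus (comp_op psi hpsi (A' f)) (scal l (A' f))))).
    + exact (f_equal (fun g => A (S g)) F).
    + exact (eq_trans (f_equal A (SL (A' f))) (AA' f)).
  - intros f.
    transitivity (A (minus (comp_op psi hpsi (S (A' f))) (scal l (S (A' f))))).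
    + apply schwartz_ext; intros x; simpl; rewrite E; reflexivity.
    + exact (eq_trans (f_equal A (SR (A' f))) (AA' f)).
Qed.

(** * Derivatives of a composition with a quadratic *)

Lemma rschwartz_ex_derive (u : R -> R) :
  rschwartz u -> forall n x, ex_derive (Derive_n u n) x.
Proof. intros [H _] n x; exact (H (S n) x). Qed.

Lemma Derive_n_shift (u : R -> R) (n : nat) (x : R) :
  Derive_n u (S n) x = Derive_n (Derive u) n x.
Proof.
  change (Derive u) with (Derive_n u 1); rewrite Derive_n_comp; f_equal; lia.
Qed.

(** Leibniz' rule when one factor has degree one: two terms survive.  For l = 0 the
    second one is killed by the coefficient l, whatever [pred] returns. *)
Lemma Derive_n_affine_mult (p q : R) (v : R -> R) (l : nat) (x : R) :
  (forall n y, ex_derive (Derive_n v n) y) ->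
  Derive_n (fun t => (p + q * t) * v t) l x =
  (p + q * x) * Derive_n v l x + INR l * q * Derive_n v (pred l) x.
Proof.
  intros Hv; revert x; induction l as [|l IH]; intros x.
  - simpl; ring.
  - change (Derive (Derive_n (fun t => (p + q * t) * v t) l) x =
      (p + q * x) * Derive_n v (S l) x + INR (S l) * q * Derive_n v l x).
    rewrite (Derive_ext _ _ x IH).
    destruct l as [|l].
    + change (Derive_n v 1 x) with (Derive v x).
      apply is_derive_unique.
      pose proof (Hv 0%nat x) as H0; simpl in H0.
      apply is_derive_ext with (fun t => (p + q * t) * v t);
        [intros t; simpl; ring|].
      auto_derive; [exact H0|]; change (Derive_n v 0 x) with (v x).
      change (Derive (fun x0 => v x0) x) with (Derive v x); simpl; ring.
    + pose proof (Hv (S l) x) as H1; pose proof (Hv l x) as H0.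
      change (pred (S l)) with l.
      apply is_derive_unique.
      replace (Derive_n v (S (S l)) x) with (Derive (Derive_n v (S l)) x)
        by reflexivity.
      set (w := Derive_n v (S l)) in *.
      assert (Hw : Derive (Derive_n v l) x = w x) by reflexivity.
      set (w0 := Derive_n v l) in *.
      auto_derive; [split; [exact H1|split; [exact H0|exact I]]|].
      change (Derive (fun x0 => w0 x0) x) with (Derive w0 x).
      change (Derive (fun x0 => w x0) x) with (Derive w x).
      rewrite Hw, (S_INR (S l)).
      change (match l with 0%nat => 1 | S _ => INR l + 1 end) with (INR (S l)); ring.
Qed.

Definition slope (b1 b2 x : R) : R := b1 + 2 * b2 * x.

Lemma Derive_comp_quadratic (b0 b1 b2 : R) (u : R -> R) (x : R) : rschwartz u ->
  Derive (fun t => u (quadratic b0 b1 b2 t)) x =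
  slope b1 b2 x * Derive u (quadratic b0 b1 b2 x).
Proof.
  intros Hu.
  pose proof (rschwartz_ex_derive u Hu 0 (quadratic b0 b1 b2 x)) as H; simpl in H.
  apply is_derive_unique; unfold quadratic, slope in *.
  auto_derive.
  - replace (b0 + b1 * x + b2 * (x * x)) with (b0 + b1 * x + b2 * x ^ 2) by ring.
    exact H.
  - replace (b0 + b1 * x + b2 * (x * x)) with (b0 + b1 * x + b2 * x ^ 2) by ring.
    change (b0 + b1 * x + b2 * (x * (x * 1))) with (b0 + b1 * x + b2 * x ^ 2).
    change (Derive (fun x0 => u x0)) with (Derive u); ring.
Qed.

(** Since (u o phi)' = phi' (u' o phi) and phi' is affine, the derivatives of
    u o phi obey a two-term recursion in which u is replaced by u'.  This replaces
    the formula of Faa di Bruno. *)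
Lemma Derive_n_comp_quadratic_S (b0 b1 b2 : R) (hb2 : b2 <> 0)
    (u : R -> R) (l : nat) (x : R) : rschwartz u ->
  Derive_n (fun t => u (quadratic b0 b1 b2 t)) (S l) x =
  slope b1 b2 x * Derive_n (fun t => Derive u (quadratic b0 b1 b2 t)) l x +
  INR l * (2 * b2) * Derive_n (fun t => Derive u (quadratic b0 b1 b2 t)) (pred l) x.
Proof.
  intros Hu; rewrite Derive_n_shift.
  rewrite (Derive_n_ext _ (fun t => slope b1 b2 t * Derive u (quadratic b0 b1 b2 t)))
    by (intros t; apply Derive_comp_quadratic, Hu).
  apply (Derive_n_affine_mult b1 (2 * b2) (fun t => Derive u (quadratic b0 b1 b2 t))).
  apply rschwartz_ex_derive, rschwartz_quadratic, rschwartz_Derive, Hu.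
  exact hb2.
Qed.

(** Truncated below by 1, so that its powers are monotone in the exponent. *)
Definition steepness (b1 b2 x : R) : R := Rmax 1 (Rabs (slope b1 b2 x)).

Lemma steepness_ge1 (b1 b2 x : R) : 1 <= steepness b1 b2 x.
Proof. apply Rmax_l. Qed.

(** Each use of the recursion costs a factor phi' or the constant phi'', so the
    error terms carry at most l factors of size max (1, |phi'|); the bound B is
    requested of the derivatives of order < l only. *)
Lemma Derive_n_comp_quadratic_lead (b0 b1 b2 : R) (hb2 : b2 <> 0) (l : nat) :
  exists K, 0 <= K /\
  forall (u : R -> R) (x B : R), rschwartz u -> 
  (forall i, (i < l)%nat -> Rabs (Derive_n u i (quadratic b0 b1 b2 x)) <= B) ->
  0 <= B ->
  Rabs (Derive_n (fun t => u (quadratic b0 b1 b2 t)) l x -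
        slope b1 b2 x ^ l * Derive_n u l (quadratic b0 b1 b2 x))
    <= K * steepness b1 b2 x ^ l * B.
Proof.
  induction l as [l IH] using Wf_nat.lt_wf_ind; destruct l as [|l].
  { exists 0; split; [lra|]; intros u x B _ _ _; simpl.
    replace (u (quadratic b0 b1 b2 x) - 1 * u (quadratic b0 b1 b2 x)) with 0 by ring.
    rewrite Rabs_R0; lra. }
  destruct (IH l ltac:(lia)) as [K1 [HK1 H1]].
  destruct l as [|l].
  { exists 0; split; [lra|]; intros u x B Hu _ _.
    change (Derive_n (fun t => u (quadratic b0 b1 b2 t)) 1 x) with
      (Derive (fun t => u (quadratic b0 b1 b2 t)) x).
    change (Derive_n u 1) with (Derive u).
    rewrite (Derive_comp_quadratic b0 b1 b2 u x Hu), pow_1, Rminus_diag, Rabs_R0; lra. }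
  destruct (IH l ltac:(lia)) as [K0 [HK0 H0]]; clear IH.
  set (q := INR (S l) * (2 * Rabs b2)).
  assert (Hq : 0 <= q).
  { apply Rmult_le_pos; [apply pos_INR|]; pose proof (Rabs_pos b2); lra. }
  exists (K1 + q * (1 + K0)); split; [nra|].
  intros u x B Hu HB HB0.
  pose proof (rschwartz_Derive u Hu) as Hu'.
  pose proof (steepness_ge1 b1 b2 x) as Hm1.
  assert (Hms : Rabs (slope b1 b2 x) <= steepness b1 b2 x) by apply Rmax_r.
  set (m := steepness b1 b2 x) in *.
  assert (HB' : forall i, (i < S l)%nat ->
    Rabs (Derive_n (Derive u) i (quadratic b0 b1 b2 x)) <= B).
  { intros i Hi; rewrite <- Derive_n_shift; apply HB; lia. }
  specialize (H1 (Derive u) x B Hu' HB' HB0).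
  specialize (H0 (Derive u) x B Hu' ltac:(intros; apply HB'; lia) HB0).
  rewrite (Derive_n_comp_quadratic_S b0 b1 b2 hb2 u (S l) x Hu).
  rewrite (Derive_n_shift u (S l)).
  change (pred (S l)) with l; fold m in H1, H0.
  set (D1 := Derive_n (fun t => Derive u (quadratic b0 b1 b2 t)) (S l) x) in *.
  set (D0 := Derive_n (fun t => Derive u (quadratic b0 b1 b2 t)) l x) in *.
  set (d1 := Derive_n (Derive u) (S l) (quadratic b0 b1 b2 x)) in *.
  pose proof (HB' l ltac:(lia)) as Hd0.
  set (d0 := Derive_n (Derive u) l (quadratic b0 b1 b2 x)) in *.
  assert (Pm : 0 < m ^ l) by (apply pow_lt; lra).
  assert (Ps : Rabs (slope b1 b2 x ^ l) <= m ^ l).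
  { rewrite <- RPow_abs; apply pow_incr; split; [apply Rabs_pos | exact Hms]. }
  assert (HD0 : Rabs D0 <= (1 + K0) * m ^ l * B).
  { replace D0 with ((D0 - slope b1 b2 x ^ l * d0) + slope b1 b2 x ^ l * d0) by ring.
    eapply Rle_trans; [apply Rabs_triang|].
    rewrite (Rabs_mult (slope b1 b2 x ^ l) d0).
    assert (Rabs (slope b1 b2 x ^ l) * Rabs d0 <= m ^ l * B)
      by (apply Rmult_le_compat; auto using Rabs_pos).
    lra. }
  replace (slope b1 b2 x * D1 + INR (S l) * (2 * b2) * D0 -
      slope b1 b2 x ^ S (S l) * d1)
    with (slope b1 b2 x * (D1 - slope b1 b2 x ^ S l * d1) + INR (S l) * (2 * b2) * D0)
    by (simpl; ring).
  eapply Rle_trans; [apply Rabs_triang|].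
  rewrite !Rabs_mult, (Rabs_pos_eq (INR (S l))) by apply pos_INR.
  rewrite (Rabs_pos_eq 2) by lra; fold q.
  assert (T1 : Rabs (slope b1 b2 x) * Rabs (D1 - slope b1 b2 x ^ S l * d1) <=
    m * (K1 * m ^ S l * B)).
  { apply Rmult_le_compat; auto using Rabs_pos. }
  assert (T2 : q * Rabs D0 <= q * ((1 + K0) * m ^ l * B))
    by (apply Rmult_le_compat_l; assumption).
  assert (T3 : m ^ l <= m ^ S (S l)) by (apply Rle_pow; [lra | lia]).
  assert (T4 : q * ((1 + K0) * m ^ l * B) <= q * ((1 + K0) * m ^ S (S l) * B)).
  { apply Rmult_le_compat_l; [exact Hq|].
    apply Rmult_le_compat_r; [exact HB0|].
    apply Rmult_le_compat_l; [lra | exact T3]. }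
  replace ((K1 + q * (1 + K0)) * m ^ S (S l) * B) with
    (m * (K1 * m ^ S l * B) + q * ((1 + K0) * m ^ S (S l) * B))
    by (simpl; ring).
  lra.
Qed.

(** The case B = 0 of the previous estimate. *)
Lemma Derive_n_comp_quadratic_vanishing (b0 b1 b2 : R) (hb2 : b2 <> 0)
    (l : nat) (u : R -> R) (x : R) :
  rschwartz u -> (forall i, (i < l)%nat -> Derive_n u i (quadratic b0 b1 b2 x) = 0) ->
  Derive_n (fun t => u (quadratic b0 b1 b2 t)) l x =
    slope b1 b2 x ^ l * Derive_n u l (quadratic b0 b1 b2 x).
Proof.
  intros Hu H0; destruct (Derive_n_comp_quadratic_lead b0 b1 b2 hb2 l) as [K [_ H]].
  specialize (H u x 0 Hu); rewrite Rmult_0_r in H.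
  apply Rminus_diag_uniq.
  destruct (Req_dec (Derive_n (fun t => u (quadratic b0 b1 b2 t)) l x -
    slope b1 b2 x ^ l * Derive_n u l (quadratic b0 b1 b2 x)) 0) as [E|E]; [exact E|].
  apply Rabs_pos_lt in E; exfalso.
  apply Rlt_not_le in E; apply E, H; [|lra].
  intros i Hi; rewrite H0 by exact Hi; rewrite Rabs_R0; lra.
Qed.

Lemma uniform_constant (P : nat -> R -> Prop) :
  (forall i K K', K <= K' -> P i K -> P i K') ->
  (forall i, exists K, 0 <= K /\ P i K) ->
  forall n, exists K, 0 <= K /\ forall i, (i <= n)%nat -> P i K.
Proof.
  intros Hm HP n; induction n as [|n [K [HK IH]]].
  - destruct (HP 0%nat) as [K [HK H]]; exists K; split; [exact HK|].
    intros i Hi; replace i with 0%nat by lia; exact H.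
  - destruct (HP (S n)) as [K' [HK' H]]; exists (Rmax K K'); split.
    + eapply Rle_trans; [exact HK | apply Rmax_l].
    + intros i Hi; destruct (Nat.eq_dec i (S n)) as [->|Hn].
      * apply Hm with K'; [apply Rmax_r | exact H].
      * apply Hm with K; [apply Rmax_l | apply IH; lia].
Qed.

(** In the matrix that expresses the jet of u o phi through that of u, the diagonal
    entries are powers of phi'; conjugating by diag (eta^i) multiplies the other
    entries by positive powers of eta, which makes them negligible. *)
Lemma jet_comp_quadratic (b0 b1 b2 : R) (hb2 : b2 <> 0) (n : nat) (eps : R) : 0 < eps ->
  exists eta, 0 < eta <= 1 /\ forall (u : R -> R) (x B : R), rschwartz u ->
  (forall i, (i <= n)%nat ->
    eta ^ i * Rabs (Derive_n u i (quadratic b0 b1 b2 x)) <= B) ->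
  forall i, (i <= n)%nat ->
    eta ^ i * Rabs (Derive_n (fun t => u (quadratic b0 b1 b2 t)) i x) <=
      (1 + eps) * (steepness b1 b2 x ^ n * B).
Proof.
  intros He.
  destruct (uniform_constant (fun l K =>  
    forall (u : R -> R) (x B : R), rschwartz u -> 
    (forall i, (i < l)%nat -> Rabs (Derive_n u i (quadratic b0 b1 b2 x)) <= B) ->
    0 <= B ->
    Rabs (Derive_n (fun t => u (quadratic b0 b1 b2 t)) l x -
        slope b1 b2 x ^ l * Derive_n u l (quadratic b0 b1 b2 x))
    <= K * steepness b1 b2 x ^ l * B)) with n as [K [HK HL]].
  { intros i K K' HKK H u x B Hu HB HB0.
    eapply Rle_trans; [apply (H u x B Hu HB HB0)|].
    apply Rmult_le_compat_r; [exact HB0|].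
    apply Rmult_le_compat_r; [apply pow_le|exact HKK].
    pose proof (steepness_ge1 b1 b2 x); lra. }
  { apply (Derive_n_comp_quadratic_lead b0 b1 b2 hb2). }
  set (eta := Rmin 1 (eps / (K + 1))).
  assert (E1 : eta <= 1) by apply Rmin_l.
  assert (E2 : eta * K <= eps).
  { assert (eta <= eps / (K + 1)) by apply Rmin_r.
    apply Rle_trans with (eps / (K + 1) * K); [nra|].
    apply Rmult_le_reg_r with (K + 1); [lra|].
    replace (eps / (K + 1) * K * (K + 1)) with (eps * K) by (field; lra); nra. }
  assert (E0 : 0 < eta).
  { apply Rmin_pos; [lra | apply Rdiv_lt_0_compat; lra]. }
  exists eta; split; [lra|]; intros u x B Hu HB l Hl.
  assert (HB0 : 0 <= B).
  { eapply Rle_trans; [|apply (HB 0%nat ltac:(lia))].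
    apply Rmult_le_pos; [apply pow_le; lra | apply Rabs_pos]. }
  pose proof (steepness_ge1 b1 b2 x) as Hm1.
  assert (Hms : Rabs (slope b1 b2 x) <= steepness b1 b2 x) by apply Rmax_r.
  specialize (HL l Hl u x); set (m := steepness b1 b2 x) in *.
  assert (Pe : forall i, 0 < eta ^ i) by (intros i; apply pow_lt; lra).
  set (D := Derive_n (fun t => u (quadratic b0 b1 b2 t)) l x) in *.
  pose proof (HB l Hl) as Hd; set (d := Derive_n u l (quadratic b0 b1 b2 x)) in *.
  assert (Hmn : m ^ l <= m ^ n) by (apply Rle_pow; [lra | lia]).
  assert (Pml : 0 < m ^ l) by (apply pow_lt; lra).
  assert (L : eta ^ l * Rabs (D - slope b1 b2 x ^ l * d) <= eps * (m ^ l * B)).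
  { destruct l as [|l].
    - specialize (HL 0 Hu ltac:(intros; lia) ltac:(lra)).
      rewrite Rmult_0_r in HL; simpl in HL |- *; nra.
    - specialize (HL (B / eta ^ l) Hu).
      assert (A : Rabs (D - slope b1 b2 x ^ S l * d) <= K * m ^ S l * (B / eta ^ l)).
      { apply HL.
        - intros i Hi; apply Rmult_le_reg_l with (eta ^ l); [apply Pe|].
          replace (eta ^ l * (B / eta ^ l)) with B
            by (field; apply Rgt_not_eq, Pe).
          eapply Rle_trans; [|apply (HB i ltac:(lia))].
          apply Rmult_le_compat_r; [apply Rabs_pos|].
          replace l with ((l - i) + i)%nat by lia; rewrite pow_add.
          rewrite <- (Rmult_1_l (eta ^ i)) at 2.
          apply Rmult_le_compat_r; [apply Rlt_le, Pe|].
          rewrite <- (pow1 (l - i)); apply pow_incr; lra.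
        - apply Rle_mult_inv_pos; [exact HB0 | apply Pe]. }
      apply Rle_trans with (eta ^ S l * (K * m ^ S l * (B / eta ^ l))).
      + apply Rmult_le_compat_l; [apply Rlt_le, Pe | exact A].
      + replace (eta ^ S l * (K * m ^ S l * (B / eta ^ l)))
          with ((eta * K) * (m ^ S l * B))
          by (simpl; field; apply Rgt_not_eq, Pe).
        apply Rmult_le_compat_r; [apply Rmult_le_pos; lra | exact E2]. }
  assert (M : eta ^ l * Rabs (slope b1 b2 x ^ l * d) <= m ^ l * B).
  { rewrite Rabs_mult, <- RPow_abs.
    replace (eta ^ l * (Rabs (slope b1 b2 x) ^ l * Rabs d))
      with (Rabs (slope b1 b2 x) ^ l * (eta ^ l * Rabs d)) by ring.
    apply Rmult_le_compat; try assumption.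
    - apply pow_le, Rabs_pos.
    - apply Rmult_le_pos; [apply Rlt_le, Pe | apply Rabs_pos].
    - apply pow_incr; split; [apply Rabs_pos | exact Hms]. }
  apply Rle_trans with ((1 + eps) * (m ^ l * B)).
  - replace D with ((D - slope b1 b2 x ^ l * d) + slope b1 b2 x ^ l * d) by ring.
    pose proof (Rabs_triang (D - slope b1 b2 x ^ l * d) (slope b1 b2 x ^ l * d)) as T.
    apply Rle_trans with (eta ^ l * (Rabs (D - slope b1 b2 x ^ l * d) + 
      Rabs (slope b1 b2 x ^ l * d))).
    + apply Rmult_le_compat_l; [apply Rlt_le, Pe | exact T].
    + lra.
  - apply Rmult_le_compat_l; [lra|]; apply Rmult_le_compat_r; assumption.
Qed.

(** * Growth of the powers of the composition operator *)

Lemma rschwartz_iter_quadratic (b0 b1 b2 : R) (hb2 : b2 <> 0) (u : R -> R) (j : nat) :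
  rschwartz u -> rschwartz (Nat.iter j (fun v t => v (quadratic b0 b1 b2 t)) u).
Proof.
  intros Hu; induction j as [|j IH]; [exact Hu|]; simpl.
  apply (rschwartz_quadratic b0 b1 b2 _ hb2 IH).
Qed.

(** Iterating the one-step estimate: the weight turns the pointwise expansion
    factor, which depends on x, into the constant r. *)
Lemma weighted_jets_contract (b0 b1 b2 : R) (hb2 : b2 <> 0) (n : nat)
    (W : R -> R) (r0 r : R) :
  (forall x, 0 < W x) -> 0 < r0 < r ->
  (forall x, steepness b1 b2 x ^ n * W x <= r0 * W (quadratic b0 b1 b2 x)) ->
  exists eta, 0 < eta <= 1 /\ forall (u : R -> R) (B : R), rschwartz u ->
  (forall i y, (i <= n)%nat -> W y * (eta ^ i * Rabs (Derive_n u i y)) <= B) ->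
  forall j i x, (i <= n)%nat ->
    W x * (eta ^ i * Rabs (Derive_n
      (Nat.iter j (fun v t => v (quadratic b0 b1 b2 t)) u) i x)) <= r ^ j * B.
Proof.
  intros HW Hr Hm.
  destruct (jet_comp_quadratic b0 b1 b2 hb2 n (r / r0 - 1)) as [eta [He H]].
  { apply Rlt_0_minus, Rmult_lt_reg_r with r0; [lra|].
    unfold Rdiv; rewrite Rmult_assoc, Rinv_l; lra. }
  exists eta; split; [exact He|]; intros u B Hu HB j.
  induction j as [|j IH]; intros i x Hi.
  { simpl; rewrite Rmult_1_l; apply HB, Hi. }
  pose proof (rschwartz_iter_quadratic b0 b1 b2 hb2 u j Hu) as Hj; simpl Nat.iter.
  set (v := Nat.iter j _ u) in *; set (y := quadratic b0 b1 b2 x).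
  specialize (H v x (r ^ j * B / W y) Hj).
  pose proof (HW x) as Wx; pose proof (HW y) as Wy.
  apply Rle_trans with
    (W x * ((1 + (r / r0 - 1)) * (steepness b1 b2 x ^ n * (r ^ j * B / W y)))).
  - apply Rmult_le_compat_l; [lra|]; apply H; [|exact Hi].
    intros l Hl; apply Rmult_le_reg_l with (W y); [exact Wy|].
    replace (W y * (r ^ j * B / W y)) with (r ^ j * B) by (field; lra).
    apply IH, Hl.
  - assert (HB0 : 0 <= r ^ j * B).
    { eapply Rle_trans; [|apply (IH 0%nat 0 ltac:(lia))].
      apply Rmult_le_pos; [apply Rlt_le, HW|]; simpl.
      rewrite Rmult_1_l; apply Rabs_pos. }
    replace (W x * ((1 + (r / r0 - 1)) *
      (steepness b1 b2 x ^ n * (r ^ j * B / W y)))) with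
      ((steepness b1 b2 x ^ n * W x) * (r / r0 * (r ^ j * B / W y)))
      by (field; lra).
    apply Rle_trans with (r0 * W y * (r / r0 * (r ^ j * B / W y))).
    + apply Rmult_le_compat_r; [|apply Hm].
      apply Rmult_le_pos; apply Rle_mult_inv_pos; lra.
    + right; simpl; field; lra.
Qed.

(** The spectral radius of T is at most rho, seminorm by seminorm: the rate r may
    depend on the seminorm, but stays below rho. *)
Definition powers_bounded (T : SchwartzSpace -> SchwartzSpace) (rho : R) : Prop :=
  forall k n : nat, exists (K : nat) (M r : R), 0 <= r < rho /\
  forall (j : nat) (f : SchwartzSpace) (B : R), seminorms_le K B f ->
  forall x, Rabs x ^ k * Cmod (CDerive_n (Nat.iter j T f) n x) <= M * r ^ j * B.

Lemma iter_comp_op (phi : R -> R) (hphi : symbol phi) (f : SchwartzSpace) (j : nat) :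
  sfun (Nat.iter j (comp_op phi hphi) f) = Nat.iter j (fun v t => v (phi t)) (sfun f).
Proof. induction j as [|j IH]; [reflexivity|]; simpl; rewrite IH; reflexivity. Qed.

(** Used with [h] the real or the imaginary part. *)
Lemma iter_comp_post {A B : Type} (h : A -> B) (phi : R -> R) (f : R -> A) (j : nat) :
  (fun t => h (Nat.iter j (fun v s => v (phi s)) f t)) =
  Nat.iter j (fun v s => v (phi s)) (fun t => h (f t)).
Proof. induction j as [|j IH]; [reflexivity|]; simpl; rewrite <- IH; reflexivity. Qed.

Lemma Cmod_parts_le (z : C) : Rabs (fst z) <= Cmod z /\ Rabs (snd z) <= Cmod z.
Proof.
  pose proof (Rmax_Cmod z); split; (eapply Rle_trans; [|exact H]).
  - apply Rmax_l.
  - apply Rmax_r.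
Qed.

Lemma seminorms_le_parts (K : nat) (B : R) (f : R -> C) : seminorms_le K B f ->
  forall i j x, (i <= K)%nat -> (j <= K)%nat ->
    Rabs x ^ i * Rabs (Derive_n (fun t => Re (f t)) j x) <= B /\
    Rabs x ^ i * Rabs (Derive_n (fun t => Im (f t)) j x) <= B.
Proof.
  intros H i j x Hi Hj; specialize (H i j x Hi Hj).
  pose proof (pow_le _ i (Rabs_pos x)).
  destruct (Cmod_parts_le (CDerive_n f j x)) as [P1 P2].
  split; (eapply Rle_trans; [|exact H]); apply Rmult_le_compat_l; assumption.
Qed.

Lemma seminorms_le_ge0 (K : nat) (B : R) (f : R -> C) : seminorms_le K B f -> 0 <= B.
Proof.
  intros H; eapply Rle_trans; [|apply (H 0%nat 0%nat 0); lia].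
  apply Rmult_le_pos; [apply pow_le, Rabs_pos | apply Cmod_ge_0].
Qed.

(** The lower bound |x|^k <= W makes the weighted norm dominate the seminorm that
    is to be estimated, and the polynomial upper bound makes it finite on Schwartz
    functions. *)
Lemma weight_powers_bounded (c b1 b2 : R) (hb2 : b2 <> 0) (rho : R) :
  (forall k n : nat, exists (W : R -> R) (A r0 : R) (Q : nat), 0 < r0 < rho /\
    (forall x, 0 < W x) /\
    (forall x, Rabs x ^ k <= W x <= A * (1 + Rabs x) ^ Q) /\
    forall x, steepness b1 b2 x ^ n * W x <= r0 * W (quadratic c b1 b2 x)) ->
  powers_bounded (comp_op (quadratic c b1 b2) (quadratic_symbol c b1 b2 hb2)) rho.
Proof.
  intros Hyp k n; destruct (Hyp k n) as [W [A [r0 [Q [Hr [HW [HkW Hst]]]]]]].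
  set (r := (r0 + rho) / 2).
  destruct (weighted_jets_contract c b1 b2 hb2 n W r0 r HW) as [eta [He H]];
    [unfold r; lra | exact Hst |].
  assert (HA : 0 <= A).
  { pose proof (HW 0); specialize (HkW 0).
    rewrite Rabs_R0, Rplus_0_r, pow1 in HkW; lra. }
  assert (Pe : forall i, 0 < eta ^ i) by (intros i; apply pow_lt; lra).
  assert (P2 : 0 < 2 ^ Q) by (apply pow_lt; lra).
  exists (max Q n), (2 * (/ eta ^ n * (A * (2 ^ Q * 2)))), r.
  split; [unfold r; lra|]; intros j f B HB x.
  pose proof (seminorms_le_ge0 _ _ _ HB) as HB0.
  assert (key : forall u, rschwartz u ->
    (forall i l y, (i <= max Q n)%nat -> (l <= max Q n)%nat ->
      Rabs y ^ i * Rabs (Derive_n u l y) <= B) ->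
    Rabs x ^ k * Rabs (Derive_n
      (Nat.iter j (fun v t => v (quadratic c b1 b2 t)) u) n x) <=
    / eta ^ n * (A * (2 ^ Q * 2)) * r ^ j * B).
  { intros u Hu Hb.
    specialize (H u (A * (2 ^ Q * 2) * B) Hu).
    assert (H' := fun h => H h j n x (Nat.le_refl n)); clear H.
    set (D := Rabs _) in *.
    assert (HD : 0 <= D) by apply Rabs_pos.
    apply Rle_trans with (W x * D).
    { apply Rmult_le_compat_r; [exact HD | apply HkW]. }
    apply Rmult_le_reg_l with (eta ^ n); [apply Pe|].
    replace (eta ^ n * (W x * D)) with (W x * (eta ^ n * D)) by ring.
    replace (eta ^ n * (/ eta ^ n * (A * (2 ^ Q * 2)) * r ^ j * B))
      with (r ^ j * (A * (2 ^ Q * 2) * B)) by (field; apply Rgt_not_eq, Pe).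
    apply H'; clear H'; intros i y Hi.
    set (d := Rabs (Derive_n u i y)).
    assert (Hd : 0 <= d) by apply Rabs_pos.
    assert (d1 : Rabs y ^ Q * d <= B) by (apply Hb; lia).
    assert (d0 : d <= B).
    { pose proof (Hb 0%nat i y ltac:(lia) ltac:(lia)) as Z; simpl in Z.
      unfold d; lra. }
    assert (He1 : eta ^ i <= 1) by (rewrite <- (pow1 i); apply pow_incr; lra).
    apply Rle_trans with (A * (1 + Rabs y) ^ Q * d).
    { apply Rmult_le_compat; [apply Rlt_le, HW | | apply HkW|].
      - apply Rmult_le_pos; [apply Rlt_le, Pe | exact Hd].
      - nra. }
    pose proof (pow_1_plus (Rabs y) Q (Rabs_pos y)) as P.
    rewrite !Rmult_assoc; apply Rmult_le_compat_l; [exact HA|].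
    apply Rle_trans with (2 ^ Q * (1 + Rabs y ^ Q) * d).
    { apply Rmult_le_compat_r; assumption. }
    rewrite Rmult_assoc; apply Rmult_le_compat_l; [lra|]; lra. }
  destruct (proj1 (schwartz_parts f) (sfunP f)) as [H1 H2].
  pose proof (key _ H1 (fun i l y Hi Hl => proj1
    (seminorms_le_parts _ _ _ HB i l y Hi Hl))) as K1.
  pose proof (key _ H2 (fun i l y Hi Hl => proj2
    (seminorms_le_parts _ _ _ HB i l y Hi Hl))) as K2.
  rewrite iter_comp_op; unfold CDerive_n; rewrite 2!iter_comp_post.
  eapply Rle_trans; [apply Rmult_le_compat_l;
    [apply pow_le, Rabs_pos | apply Cmod_le_abs]|]; simpl fst; simpl snd.
  rewrite Rmult_plus_distr_l; lra.
Qed.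

Lemma steepness_psi (x : R) : steepness 0 1 x <= 1 + 2 * Rabs x /\
  (forall e, 0 < e -> Rabs x <= (1 + e) / 2 -> steepness 0 1 x <= 1 + e).
Proof.
  unfold steepness, slope; replace (0 + 2 * 1 * x) with (2 * x) by ring.
  rewrite Rabs_mult, (Rabs_pos_eq 2) by lra; pose proof (Rabs_pos x); split.
  - apply Rmax_lub; lra.
  - intros e He Hx; apply Rmax_lub; lra.
Qed.

Lemma quadratic_psi_abs (c x : R) : 1 / 4 <= c ->
  Rabs (quadratic c 0 1 x) = Rabs x ^ 2 + c.
Proof.
  intros Hc; unfold quadratic; rewrite pow2_abs; rewrite Rabs_pos_eq; nra.
Qed.

(** With c > 1/4 the quotient (1 + |psi x|) / (1 + |x|) is bounded below by some
    1 + kap > 1, and by a multiple of the steepness.  In W = (1 + |x|)^(n+m) the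
    exponent n pays for the steepness, and m for the constants 4^n and 1 / r0. *)
Lemma weight_no_fixed_point (c rho : R) : 1 / 4 < c -> 0 < rho ->
  forall k n : nat, exists (W : R -> R) (A r0 : R) (Q : nat), 0 < r0 < rho /\
    (forall x, 0 < W x) /\
    (forall x, Rabs x ^ k <= W x <= A * (1 + Rabs x) ^ Q) /\
    forall x, steepness 0 1 x ^ n * W x <= r0 * W (quadratic c 0 1 x).
Proof.
  intros Hc Hrho k n.
  (* (1 + kap) (1 + t) <= 1 + t^2 + c for all t as soon as
     (1 + kap)^2 <= 4 (c - kap), which follows from 7 kap <= 4 c - 1, kap <= 1. *)
  set (kap := Rmin 1 ((4 * c - 1) / 7)).
  assert (K1 : kap <= 1) by apply Rmin_l.
  assert (K2 : kap <= (4 * c - 1) / 7) by apply Rmin_r.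
  assert (K0 : 0 < kap) by (apply Rmin_pos; lra).
  destruct (Pow_x_infinity (1 + kap)) with (b := 4 ^ n / (rho / 2)) as [m0 Hm0].
  { rewrite Rabs_pos_eq; lra. }
  set (m := (m0 + k)%nat).
  assert (Hm : 4 ^ n <= rho / 2 * (1 + kap) ^ m).
  { specialize (Hm0 m ltac:(unfold m; lia)).
    rewrite Rabs_pos_eq in Hm0 by (apply pow_le; lra).
    apply Rge_le in Hm0.
    apply Rmult_le_compat_l with (r := rho / 2) in Hm0; [|lra].
    replace (rho / 2 * (4 ^ n / (rho / 2))) with (4 ^ n) in Hm0 by (field; lra).
    exact Hm0. }
  exists (fun x => (1 + Rabs x) ^ (n + m)), 1, (rho / 2), (n + m)%nat.
  split; [lra|]; split; [|split].
  - intros x; apply pow_lt; pose proof (Rabs_pos x); lra.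
  - intros x; pose proof (Rabs_pos x); split; [|lra].
    apply Rle_trans with ((1 + Rabs x) ^ k); [apply pow_incr; lra|].
    apply Rle_pow; [lra | unfold m; lia].
  - intros x; rewrite (quadratic_psi_abs c x) by lra.
    set (t := Rabs x); assert (Ht : 0 <= t) by apply Rabs_pos.
    destruct (steepness_psi x) as [Hs _]; fold t in Hs.
    pose proof (steepness_ge1 0 1 x) as Hs1.
    assert (G1 : (1 + kap) * (1 + t) <= 1 + (t ^ 2 + c)).
    { assert (0 <= (t - (1 + kap) / 2) ^ 2) by apply pow2_ge_0.
      assert ((1 + kap) ^ 2 <= 4 * (c - kap)) by nra.
      nra. }
    assert (G2 : steepness 0 1 x * (1 + t) <= 4 * (1 + (t ^ 2 + c))) by nra.
    set (z := 1 + (t ^ 2 + c)) in *.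
    assert (Hz : 0 <= z) by (unfold z; nra).
    assert (P1 : steepness 0 1 x ^ n * (1 + t) ^ n <= 4 ^ n * z ^ n).
    { rewrite <- !Rpow_mult_distr; apply pow_incr; split; [nra|exact G2]. }
    assert (P2 : (1 + kap) ^ m * (1 + t) ^ m <= z ^ m).
    { rewrite <- Rpow_mult_distr; apply pow_incr; split; [nra|exact G1]. }
    assert (Z1 : 0 <= z ^ n) by (apply pow_le; exact Hz).
    assert (Z2 : 0 <= (1 + t) ^ m) by (apply pow_le; lra).
    rewrite !pow_add.
    apply Rle_trans with (4 ^ n * z ^ n * (1 + t) ^ m).
    { rewrite <- Rmult_assoc; apply Rmult_le_compat_r; assumption. }
    apply Rle_trans with (rho / 2 * (1 + kap) ^ m * z ^ n * (1 + t) ^ m).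
    { apply Rmult_le_compat_r; [exact Z2|].
      apply Rmult_le_compat_r; assumption. }
    replace (rho / 2 * (1 + kap) ^ m * z ^ n * (1 + t) ^ m) with
      (rho / 2 * z ^ n * ((1 + kap) ^ m * (1 + t) ^ m)) by ring.
    rewrite <- (Rmult_assoc (rho / 2)); apply Rmult_le_compat_l; [|exact P2].
    apply Rmult_le_pos; lra.
Qed.

Lemma exists_pow_le (n : nat) (r : R) : 1 < r ->
  exists e, 0 < e /\ (1 + e) ^ n <= r.
Proof.
  revert r; induction n as [|n IH]; intros r Hr.
  - exists 1; simpl; lra.
  - assert (Hs : 1 < sqrt r) by (rewrite <- sqrt_1; apply sqrt_lt_1; lra).
    destruct (IH _ Hs) as [e [He Hn]].
    set (d := Rmin e (sqrt r - 1)).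
    assert (D1 : d <= e) by apply Rmin_l.
    assert (D2 : d <= sqrt r - 1) by apply Rmin_r.
    assert (D0 : 0 < d) by (apply Rmin_pos; lra).
    exists d; split; [exact D0|].
    rewrite <- (sqrt_sqrt r) by lra; simpl.
    apply Rmult_le_compat; [lra | apply pow_le; lra | lra|].
    apply Rle_trans with ((1 + e) ^ n); [apply pow_incr; lra | exact Hn].
Qed.

(** Write |x| = 1/2 + q.  Where q <= e / 2 the steepness is at most 1 + e and any
    increasing function of |x| will do.  Beyond that psi moves q to q + q^2, so
    with d = e / 2 <= q the quantity d + q grows by a factor of at least 1 + q / 2,
    whose fourth power exceeds the steepness 1 + 2 q. *)
Lemma weight_parabolic (rho : R) : 1 < rho ->
  forall k n : nat, exists (W : R -> R) (A r0 : R) (Q : nat), 0 < r0 < rho /\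
    (forall x, 0 < W x) /\
    (forall x, Rabs x ^ k <= W x <= A * (1 + Rabs x) ^ Q) /\
    forall x, steepness 0 1 x ^ n * W x <= r0 * W (quadratic (1 / 4) 0 1 x).
Proof.
  intros Hrho k n.
  destruct (exists_pow_le n ((1 + rho) / 2)) as [e [He Hen]]; [lra|].
  set (d := e / 2).
  set (s := fun x => Rmax 0 (x - 1 / 2)).
  set (w := fun x => 1 + s x / d).
  assert (Hd : 0 < d) by (unfold d; lra).
  assert (Hs : forall x, 0 <= s x) by (intros x; apply Rmax_l).
  assert (Hw : forall x, 1 <= w x).
  { intros x; unfold w; pose proof (Rle_mult_inv_pos _ _ (Hs x) Hd).
    unfold Rdiv; lra. }
  set (v := fun x => w (Rabs x)).
  (* one step multiplies v ^ 4 by at least the steepness, up to 1 + e *)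
  assert (key : forall x, steepness 0 1 x * v x ^ 4 <=
    (1 + e) * v (quadratic (1 / 4) 0 1 x) ^ 4).
  { intros x; unfold v; rewrite quadratic_psi_abs by lra.
    set (t := Rabs x); assert (Ht : 0 <= t) by apply Rabs_pos.
    destruct (steepness_psi x) as [Hs1 Hs2]; fold t in Hs1, Hs2.
    assert (Hm : w t <= w (t ^ 2 + 1 / 4)).
    { unfold w, s; apply Rplus_le_compat_l, Rmult_le_compat_r;
        [apply Rlt_le, Rinv_0_lt_compat, Hd|].
      apply Rle_max_compat_l; pose proof (pow2_ge_0 (t - 1 / 2)); nra. }
    pose proof (Hw t) as Hwt.
    destruct (Rle_dec t ((1 + e) / 2)) as [Hte|Hte].
    - apply Rmult_le_compat; [|apply pow_le; lra | apply Hs2; lra |].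
      + pose proof (steepness_ge1 0 1 x); lra.
      + apply pow_incr; lra.
    - set (q := t - 1 / 2).
      assert (Hq : d <= q) by (unfold q, d; lra).
      assert (E1 : w t = (d + q) / d).
      { unfold w, s; rewrite Rmax_right by (unfold q in Hq; lra).
        fold q; field; lra. }
      assert (E2 : w (t ^ 2 + 1 / 4) = (d + q + q ^ 2) / d).
      { unfold w, s; rewrite Rmax_right.
        - unfold q; field; lra.
        - unfold q in Hq; nra. }
      rewrite E1, E2; unfold Rdiv; rewrite !Rpow_mult_distr.
      rewrite <- !Rmult_assoc; apply Rmult_le_compat_r.
      { apply pow_le, Rlt_le, Rinv_0_lt_compat, Hd. }
      assert (S1 : steepness 0 1 x <= (1 + e) * (1 + 2 * q)).
      { assert (steepness 0 1 x <= 1 + 2 * q); [|nra].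
        unfold steepness, slope; replace (0 + 2 * 1 * x) with (2 * x) by ring.
        rewrite Rabs_mult, (Rabs_pos_eq 2) by lra; fold t.
        apply Rmax_lub; unfold q; unfold q in Hq; lra. }
      assert (S2 : (1 + 2 * q) * (d + q) ^ 4 <= (d + q + q ^ 2) ^ 4).
      { assert ((d + q) * (1 + q / 2) <= d + q + q ^ 2) by nra.
        apply Rle_trans with (((d + q) * (1 + q / 2)) ^ 4).
        - rewrite Rpow_mult_distr, Rmult_comm.
          apply Rmult_le_compat_l; [apply pow_le; lra|].
          assert (0 <= q) by lra.
          assert (1 + q <= (1 + q / 2) ^ 2) by nra.
          assert (1 + 2 * q <= (1 + q) ^ 2) by nra.
          replace ((1 + q / 2) ^ 4) with (((1 + q / 2) ^ 2) ^ 2) by ring.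
          apply Rle_trans with ((1 + q) ^ 2); [assumption|].
          apply pow_incr; lra.
        - apply pow_incr; split; [nra|assumption]. }
      apply Rle_trans with ((1 + e) * (1 + 2 * q) * (d + q) ^ 4).
      + apply Rmult_le_compat_r; [apply pow_le; lra | exact S1].
      + rewrite Rmult_assoc; apply Rmult_le_compat_l; [lra | exact S2]. }
  assert (Hv : forall x, 1 <= v x) by (intros x; apply Hw).
  assert (Hv2 : forall x, v x <= (1 + / d) * (1 + Rabs x)).
  { intros x; unfold v, w, s; pose proof (Rabs_pos x).
    pose proof (Rinv_0_lt_compat _ Hd).
    assert (Rmax 0 (Rabs x - 1 / 2) <= Rabs x) by (apply Rmax_lub; lra).
    unfold Rdiv; nra. }
  assert (Hk : forall x, Rabs x <= Rabs (quadratic (1 / 4) 0 1 x)).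
  { intros x; rewrite quadratic_psi_abs by lra; set (t := Rabs x).
    pose proof (pow2_ge_0 (t - 1 / 2)); nra. }
  exists (fun x => (1 + Rabs x) ^ k * (v x ^ 4) ^ n), ((1 + / d) ^ (4 * n)),
    ((1 + rho) / 2), (k + 4 * n)%nat.
  split; [lra|]; split; [|split].
  - intros x; pose proof (Rabs_pos x); pose proof (Hv x).
    apply Rmult_lt_0_compat; repeat apply pow_lt; lra.
  - intros x; pose proof (Rabs_pos x); pose proof (Hv x); split.
    + rewrite <- (Rmult_1_r (Rabs x ^ k)); apply Rmult_le_compat.
      * apply pow_le; lra.
      * lra.
      * apply pow_incr; lra.
      * apply pow_R1_Rle, pow_R1_Rle; lra.
    + rewrite <- pow_mult, pow_add, (Rmult_comm ((1 + Rabs x) ^ k)).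
      rewrite (Rmult_comm ((1 + Rabs x) ^ k)), <- Rmult_assoc, <- Rpow_mult_distr.
      apply Rmult_le_compat_r; [apply pow_le; lra|].
      apply pow_incr; split; [lra | apply Hv2].
  - intros x; set (y := quadratic (1 / 4) 0 1 x).
    pose proof (Rabs_pos x); pose proof (Hv x); pose proof (Hv y).
    pose proof (steepness_ge1 0 1 x).
    replace (steepness 0 1 x ^ n * ((1 + Rabs x) ^ k * (v x ^ 4) ^ n)) with
      ((1 + Rabs x) ^ k * (steepness 0 1 x * v x ^ 4) ^ n)
      by (rewrite Rpow_mult_distr; ring).
    apply Rle_trans with ((1 + Rabs y) ^ k * ((1 + e) * v y ^ 4) ^ n).
    + assert (0 <= v x ^ 4) by (apply pow_le; lra).
      apply Rmult_le_compat; try (apply pow_le; nra); apply pow_incr.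
      * specialize (Hk x); fold y in Hk; lra.
      * split; [nra | apply key].
    + rewrite Rpow_mult_distr.
      replace ((1 + Rabs y) ^ k * ((1 + e) ^ n * (v y ^ 4) ^ n)) with
        ((1 + e) ^ n * ((1 + Rabs y) ^ k * (v y ^ 4) ^ n)) by ring.
      apply Rmult_le_compat_r; [|exact Hen].
      pose proof (Rabs_pos y).
      apply Rmult_le_pos; repeat apply pow_le; lra.
Qed.

(** * Series of Schwartz functions and the Neumann series *)

Lemma geometric_series_bound (a : nat -> R) (M r : R) : 0 <= r < 1 ->
  (forall j, Rabs (a j) <= M * r ^ j) ->
  ex_series a /\ Rabs (Series a) <= M / (1 - r).
Proof.
  intros Hr Ha.
  assert (G : is_series (fun j => M * r ^ j) (M * / (1 - r))).
  { apply (is_series_scal_l M (fun j => r ^ j) (/ (1 - r))).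
    apply is_series_geom; rewrite Rabs_pos_eq; lra. }
  assert (E : ex_series (fun j => Rabs (a j))).
  { apply (ex_series_le (fun j => Rabs (a j)) (fun j => M * r ^ j)).
    - intros j; change (norm (Rabs (a j))) with (Rabs (Rabs (a j))).
      rewrite Rabs_Rabsolu; apply Ha.
    - exists (M * / (1 - r)); exact G. }
  split; [apply ex_series_Rabs, E|].
  eapply Rle_trans; [apply Series_Rabs, E|].
  unfold Rdiv; rewrite <- (is_series_unique _ _ G).
  apply Series_le; [|exists (M * / (1 - r)); exact G].
  intros j; split; [apply Rabs_pos | apply Ha].
Qed.

Lemma geometric_tail (a : nat -> R) (M r : R) : 0 <= r < 1 ->
  (forall j, Rabs (a j) <= M * r ^ j) ->
  forall N, Rabs (sum_n a N - Series a) <= M * r ^ S N / (1 - r).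
Proof.
  intros Hr Ha N.
  destruct (geometric_series_bound a M r Hr Ha) as [E _].
  rewrite (Series_incr_n a (S N)) by (exact E || lia).
  change (pred (S N)) with N; rewrite <- sum_n_Reals.
  replace (sum_n a N - (sum_n a N + Series (fun k => a (S N + k)%nat))) with
    (- Series (fun k => a (S N + k)%nat)) by ring.
  rewrite Rabs_Ropp; apply (geometric_series_bound _ (M * r ^ S N) r Hr).
  intros j; rewrite Rmult_assoc, <- pow_add; apply Ha.
Qed.

Lemma geometric_CVU (f : nat -> R -> R) (M r : R) : 0 <= r < 1 ->
  (forall j x, Rabs (f j x) <= M * r ^ j) ->
  CVU_dom (fun N x => sum_n (fun j => f j x) N) (fun _ => True).
Proof.
  intros Hr Hf eps.
  assert (HM : 0 <= M).
  { specialize (Hf 0%nat 0); simpl in Hf; pose proof (Rabs_pos (f 0%nat 0)); lra. }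
  destruct (pow_lt_1_zero r) with (y := eps * (1 - r) / (M + 1)) as [N HN].
  { rewrite Rabs_pos_eq; lra. }
  { apply Rdiv_lt_0_compat; [|lra].
    apply Rmult_lt_0_compat; [apply cond_pos | lra]. }
  exists N; intros n Hn x _.
  change (real (Lim_seq (fun n => sum_n (fun j => f j x) n)))
    with (Series (fun j => f j x)).
  eapply Rle_lt_trans; [apply (geometric_tail _ M r Hr); intros j; apply Hf|].
  specialize (HN (S n) ltac:(lia)).
  assert (P : 0 <= r ^ S n) by (apply pow_le; lra).
  rewrite Rabs_pos_eq in HN by exact P.
  apply Rmult_lt_reg_r with (1 - r); [lra|].
  replace (M * r ^ S n / (1 - r) * (1 - r)) with (M * r ^ S n) by (field; lra).
  apply Rle_lt_trans with ((M + 1) * r ^ S n); [lra|].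
  apply Rmult_lt_compat_l with (r := M + 1) in HN; [|lra].
  replace ((M + 1) * (eps * (1 - r) / (M + 1))) with (eps * (1 - r)) in HN
    by (field; lra).
  exact HN.
Qed.

(** Uniform convergence of the series and of the series of derivatives. *)
Lemma geometric_series_derive (f : nat -> R -> R) (M r M' r' : R) :
  0 <= r < 1 -> 0 <= r' < 1 ->
  (forall j x, ex_derive (f j) x) ->
  (forall j x, ex_derive (Derive (f j)) x) ->
  (forall j x, Rabs (f j x) <= M * r ^ j) ->
  (forall j x, Rabs (Derive (f j) x) <= M' * r' ^ j) ->
  forall x, is_derive (fun t => Series (fun j => f j t)) x
    (Series (fun j => Derive (f j) x)).
Proof.
  intros Hr Hr' D1 D2 B1 B2 x.
  assert (S1 : forall g : nat -> R -> R, (forall j y, ex_derive (g j) y) ->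
    forall N y, is_derive (fun t => sum_n (fun j => g j t) N) y
      (sum_n (fun j => Derive (g j) y) N)).
  { intros g Hg N y; induction N as [|N IH].
    - rewrite sum_O.
      apply is_derive_ext with (g 0%nat); [intros t; rewrite sum_O; reflexivity|].
      apply Derive_correct, Hg.
    - rewrite sum_Sn.
      apply is_derive_ext with (fun t => sum_n (fun j => g j t) N + g (S N) t);
        [intros t; rewrite sum_Sn; reflexivity|].
      exact (is_derive_plus (fun t => sum_n (fun j => g j t) N) (g (S N)) y _ _
        IH (Derive_correct _ _ (Hg (S N) y))). }
  assert (E : forall N y, Derive (fun t => sum_n (fun j => f j t) N) y =
    sum_n (fun j => Derive (f j) y) N)
    by (intros N y; apply is_derive_unique, S1, D1).
  pose proof (CVU_Derive (fun N t => sum_n (fun j => f j t) N) (fun _ => True)) as H.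
  assert (H' : is_derive
    (fun y => real (Lim_seq (fun n => sum_n (fun j => f j y) n))) x
    (real (Lim_seq (fun n => Derive (fun t => sum_n (fun j => f j t) n) x)))).
  { apply H.
    - apply open_true.
    - intros a b y _ _ _; exact I.
    - apply (geometric_CVU f M r Hr B1).
    - intros n y _; eexists; apply (S1 f D1).
    - intros n y _; apply continuity_pt_filterlim.
      apply (continuous_ext (fun y => sum_n (fun j => Derive (f j) y) n));
        [intros z; symmetry; apply E|].
      apply (ex_derive_continuous (V := R_NormedModule)).
      eexists; apply (S1 (fun j => Derive (f j)) D2).
    - pose proof (geometric_CVU (fun j => Derive (f j)) M' r' Hr' B2) as C.
      intros eps; destruct (C eps) as [N HN]; exists N; intros n Hn y Hy.
      rewrite (Lim_seq_ext _ (fun n => sum_n (fun j => Derive (f j) y) n))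
        by (intros m; apply E).
      rewrite E; apply HN; assumption.
    - exact I. }
  rewrite (Lim_seq_ext _ (fun n => sum_n (fun j => Derive (f j) x) n)) in H'
    by (intros m; apply E).
  exact H'.
Qed.

Lemma rschwartz_series (u : nat -> R -> R) :
  (forall j, rschwartz (u j)) ->
  (forall k n, exists M r, 0 <= r < 1 /\
    forall j x, Rabs x ^ k * Rabs (Derive_n (u j) n x) <= M * r ^ j) ->
  rschwartz (fun x => Series (fun j => u j x)) /\
  forall n x, Derive_n (fun t => Series (fun j => u j t)) n x =
    Series (fun j => Derive_n (u j) n x).
Proof.
  intros Hu HB.
  assert (HB0 : forall n, exists M r, 0 <= r < 1 /\
    forall j x, Rabs (Derive_n (u j) n x) <= M * r ^ j).
  { intros n; destruct (HB 0%nat n) as [M [r [Hr H]]]; exists M, r.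
    split; [exact Hr|]; intros j x; specialize (H j x); simpl in H; lra. }
  assert (D : forall n x,
    is_derive (fun t => Series (fun j => Derive_n (u j) n t)) x
      (Series (fun j => Derive_n (u j) (S n) x))).
  { intros n x; destruct (HB0 n) as [M [r [Hr H]]].
    destruct (HB0 (S n)) as [M' [r' [Hr' H']]].
    apply (geometric_series_derive (fun j => Derive_n (u j) n) M r M' r' Hr Hr');
      try assumption.
    - intros j y; apply rschwartz_ex_derive, Hu.
    - intros j y; apply (rschwartz_ex_derive (u j) (Hu j) (S n)). }
  assert (E : forall n x, Derive_n (fun t => Series (fun j => u j t)) n x =
    Series (fun j => Derive_n (u j) n x)).
  { induction n as [|n IH]; intros x; [reflexivity|].
    change (Derive (Derive_n (fun t => Series (fun j => u j t)) n) x =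
      Series (fun j => Derive_n (u j) (S n) x)).
    rewrite (Derive_ext _ _ x IH); apply is_derive_unique, D. }
  split; [|exact E]; split.
  - intros [|n] x; [exact I|].
    apply (ex_derive_ext (fun t => Series (fun j => Derive_n (u j) n t)));
      [intros t; symmetry; apply E|].
    eexists; apply D.
  - intros k n; destruct (HB k n) as [M [r [Hr H]]].
    exists (M / (1 - r)); intros x; rewrite E.
    rewrite <- (Rabs_pos_eq (Rabs x ^ k)) at 1 by apply pow_le, Rabs_pos.
    rewrite <- Rabs_mult, <- Series_scal_l.
    apply geometric_series_bound; [exact Hr|]; intros j.
    rewrite Rabs_mult, (Rabs_pos_eq (Rabs x ^ k)) by apply pow_le, Rabs_pos.
    apply H.
Qed.

(** Completeness of the Schwartz space, in the form of convergence of series whose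
    seminorms decay geometrically, with a bound on the sum.  The factor 2 comes
    from treating real and imaginary parts separately. *)
Lemma schwartz_series (t : nat -> SchwartzSpace) :
  (forall k n, exists M r, 0 <= r < 1 /\
    forall j x, Rabs x ^ k * Cmod (CDerive_n (t j) n x) <= M * r ^ j) ->
  exists F : SchwartzSpace,
    (forall x, is_series (fun j => Re (t j x)) (Re (F x)) /\
               is_series (fun j => Im (t j x)) (Im (F x))) /\
    forall k n M r, 0 <= r < 1 ->
      (forall j x, Rabs x ^ k * Cmod (CDerive_n (t j) n x) <= M * r ^ j) ->
      forall x, Rabs x ^ k * Cmod (CDerive_n F n x) <= 2 * M / (1 - r).
Proof.
  intros HB.
  assert (Hre : forall (M r : R) k n j x,
    Rabs x ^ k * Cmod (CDerive_n (t j) n x) <= M * r ^ j ->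
    Rabs x ^ k * Rabs (Derive_n (fun s => Re (t j s)) n x) <= M * r ^ j /\
    Rabs x ^ k * Rabs (Derive_n (fun s => Im (t j s)) n x) <= M * r ^ j).
  { intros M r k n j x H; pose proof (pow_le _ k (Rabs_pos x)).
    destruct (Cmod_parts_le (CDerive_n (t j) n x)) as [P1 P2].
    split; (eapply Rle_trans; [|exact H]); apply Rmult_le_compat_l; assumption. }
  destruct (rschwartz_series (fun j s => Re (t j s))) as [S1 E1].
  { intros j; apply (proj1 (schwartz_parts (t j)) (sfunP (t j))). }
  { intros k n; destruct (HB k n) as [M [r [Hr H]]]; exists M, r.
    split; [exact Hr|]; intros j x; apply Hre, H. }
  destruct (rschwartz_series (fun j s => Im (t j s))) as [S2 E2].
  { intros j; apply (proj1 (schwartz_parts (t j)) (sfunP (t j))). }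
  { intros k n; destruct (HB k n) as [M [r [Hr H]]]; exists M, r.
    split; [exact Hr|]; intros j x; apply Hre, H. }
  set (F := fun x : R =>
    (Series (fun j => Re (t j x)), Series (fun j => Im (t j x))) : C).
  exists (mkSchwartz F (proj2 (schwartz_parts F) (conj S1 S2))); split.
  - intros x; simpl; destruct (HB 0%nat 0%nat) as [M [r [Hr H]]].
    split; apply Series_correct, (geometric_series_bound _ M r Hr); intros j;
      destruct (Hre M r 0%nat 0%nat j x (H j x)) as [P1 P2]; simpl in P1, P2; lra.
  - intros k n M r Hr H x; simpl.
    assert (Pk : 0 <= Rabs x ^ k) by (apply pow_le, Rabs_pos).
    eapply Rle_trans; [apply Rmult_le_compat_l; [exact Pk | apply Cmod_le_abs]|].
    unfold CDerive_n; simpl fst; simpl snd; rewrite E1, E2.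
    rewrite <- (Rabs_pos_eq (Rabs x ^ k)) at 1 by exact Pk.
    rewrite Rmult_plus_distr_l, <- !Rabs_mult, <- !Series_scal_l.
    replace (2 * M / (1 - r)) with (M / (1 - r) + M / (1 - r)) by (field; lra).
    apply Rplus_le_compat; apply geometric_series_bound; try exact Hr; intros j;
      rewrite Rabs_mult, (Rabs_pos_eq (Rabs x ^ k)) by exact Pk;
      apply (Hre M r k n j x (H j x)).
Qed.

Lemma CDerive_n_0 (f : R -> C) (x : R) : CDerive_n f 0 x = f x.
Proof. symmetry; apply surjective_pairing. Qed.

Lemma CDerive_n_scal (l : C) (f : SchwartzSpace) (n : nat) (x : R) :
  CDerive_n (scal l f : SchwartzSpace) n x = Cmult l (CDerive_n f n x).
Proof.
  destruct (proj1 (schwartz_parts f) (sfunP f)) as [[H1 _] [H2 _]].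
  unfold CDerive_n, Cmult; simpl; f_equal.
  - rewrite (Derive_n_ext _ (fun t => fst l * Re (f t) + (- snd l) * Im (f t)))
      by (intros t; unfold Re, Im; simpl; ring).
    rewrite Derive_n_plus; [rewrite !Derive_n_scal_l; unfold Rminus; ring | |];
      apply ex_loc; intros k y; apply ex_derive_n_scal_l; [apply H1 | apply H2].
  - rewrite (Derive_n_ext _ (fun t => fst l * Im (f t) + snd l * Re (f t)))
      by (intros t; unfold Re, Im; simpl; ring).
    rewrite Derive_n_plus; [rewrite !Derive_n_scal_l; ring | |];
      apply ex_loc; intros k y; apply ex_derive_n_scal_l; [apply H2 | apply H1].
Qed.

Lemma iter_eigenfunction (phi : R -> R) (hphi : symbol phi) (l : C)
    (f : SchwartzSpace) :
  (forall x, f (phi x) = Cmult l (f x)) ->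
  forall j x, Nat.iter j (comp_op phi hphi) f x = Cmult (Cpow l j) (f x).
Proof.
  intros H j; induction j as [|j IH]; intros x; simpl; [ring|].
  rewrite IH, H; simpl; ring.
Qed.

Lemma zero_of_geometric_decay (z : R) (M q : R) : 0 <= q < 1 ->
  (forall j, Rabs z <= M * q ^ j) -> z = 0.
Proof.
  intros Hq H; destruct (Req_dec z 0) as [E|E]; [exact E|exfalso].
  assert (P : 0 < Rabs z) by (apply Rabs_pos_lt, E).
  assert (HM : 0 < M) by (specialize (H 0%nat); simpl in H; lra).
  destruct (pow_lt_1_zero q) with (y := Rabs z / M) as [N HN].
  { rewrite Rabs_pos_eq; lra. }
  { apply Rdiv_lt_0_compat; assumption. }
  specialize (HN N ltac:(lia)); specialize (H N).
  rewrite Rabs_pos_eq in HN by (apply pow_le; lra).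
  apply Rmult_lt_compat_l with (r := M) in HN; [|exact HM].
  replace (M * (Rabs z / M)) with (Rabs z) in HN by (field; lra); lra.
Qed.

Lemma schwartz_seminorms_le (f : SchwartzSpace) (K : nat) :
  exists B, seminorms_le K B f.
Proof.
  assert (HB1 : forall k, exists B, 0 <= B /\ forall i, (i <= K)%nat ->
      forall y, Rabs y ^ k * Cmod (CDerive_n f i y) <= B).
    { intros k; apply (uniform_constant (fun i B =>
        forall y, Rabs y ^ k * Cmod (CDerive_n f i y) <= B)).
      - intros i B B' HB HBB y; eapply Rle_trans; [apply HBB | exact HB].
      - intros i; exists (seminorm k i f); split.
        + apply seminorm_ge0, sfunP.
        + apply seminorm_ub, sfunP. }
    destruct (uniform_constant (fun k B => forall i, (i <= K)%nat ->
      forall y, Rabs y ^ k * Cmod (CDerive_n f i y) <= B)) with K as [B [_ HB]].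
    - intros k B B' HB HBB i Hi y; eapply Rle_trans; [apply HBB, Hi | exact HB].
    - exact HB1.
    - exists B; intros i j y Hi Hj; apply HB; assumption.
Qed.

(** An eigenfunction would satisfy |l|^j |f| = |T^j f| <= M r^j with r < |l|. *)
Lemma neumann_injective (phi : R -> R) (hphi : symbol phi) (l : C) :
  l <> RtoC 0 -> powers_bounded (comp_op phi hphi) (Cmod l) ->
  forall f : SchwartzSpace, (forall x, f (phi x) = Cmult l (f x)) ->
  forall x, f x = RtoC 0.
Proof.
  intros Hl HT f Hf x.
  pose proof (Cmod_gt_0 l) as [Pl _]; specialize (Pl Hl).
  destruct (HT 0%nat 0%nat) as [K [M [r [Hr H]]]].
  destruct (schwartz_seminorms_le f K) as [B HB].
  assert (Z : Cmod (f x) = 0).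
  { apply (zero_of_geometric_decay _ (M * B) (r / Cmod l)).
    { split; [apply Rle_mult_inv_pos; lra|].
      apply Rmult_lt_reg_r with (Cmod l); [lra|].
      unfold Rdiv; rewrite Rmult_assoc, Rinv_l; lra. }
    intros j; specialize (H j f B HB x).
    rewrite CDerive_n_0, (iter_eigenfunction phi hphi l f Hf) in H.
    rewrite Cmod_mult, Cmod_pow in H; simpl in H.
    rewrite Rabs_pos_eq by apply Cmod_ge_0.
    assert (Pj : 0 < Cmod l ^ j) by (apply pow_lt; exact Pl).
    apply Rmult_le_reg_l with (Cmod l ^ j); [exact Pj|].
    unfold Rdiv; rewrite Rpow_mult_distr, pow_inv.
    replace (Cmod l ^ j * (M * B * (r ^ j * / Cmod l ^ j))) with (M * r ^ j * B)
      by (field; lra).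
    lra. }
  apply Cmod_eq_0, Z.
Qed.

(** The solution is the sum of t_j = - l^-(j+1) T^j g, for which
    l t_(j+1) = t_j o phi and l t_0 = - g.  The seminorm estimate is uniform in g,
    which makes the solution operator continuous. *)
Lemma neumann_solution (phi : R -> R) (hphi : symbol phi) (l : C) :
  l <> RtoC 0 -> powers_bounded (comp_op phi hphi) (Cmod l) ->
  forall g : SchwartzSpace, exists f : SchwartzSpace,
  (forall x, Cminus (f (phi x)) (Cmult l (f x)) = g x) /\
  forall k n K M r, 0 <= r < Cmod l ->
    (forall j (h : SchwartzSpace) B, seminorms_le K B h -> forall x,
      Rabs x ^ k * Cmod (CDerive_n (Nat.iter j (comp_op phi hphi) h) n x)
        <= M * r ^ j * B) ->
    forall B, seminorms_le K B g -> forall x,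
      Rabs x ^ k * Cmod (CDerive_n f n x) <= 2 * M / (Cmod l - r) * B.
Proof.
  intros Hl HT g; set (T := comp_op phi hphi) in *.
  pose proof (Cmod_gt_0 l) as [Pl _]; specialize (Pl Hl).
  set (t := fun j => scal (Copp (Cinv (Cpow l (S j)))) (Nat.iter j T g)
    : SchwartzSpace).
  assert (Ht : forall j n x, Cmod (CDerive_n (t j) n x) =
    / Cmod l ^ S j * Cmod (CDerive_n (Nat.iter j T g) n x)).
  { intros j n x; unfold t; rewrite CDerive_n_scal, Cmod_mult, Cmod_opp.
    rewrite Cmod_inv by (apply Cpow_nz, Hl); rewrite Cmod_pow; reflexivity. }
  assert (Hb : forall k n K M r, 0 <= r < Cmod l ->
    (forall j (h : SchwartzSpace) B, seminorms_le K B h -> forall x,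
      Rabs x ^ k * Cmod (CDerive_n (Nat.iter j T h) n x) <= M * r ^ j * B) ->
    forall B, seminorms_le K B g -> forall j x,
      Rabs x ^ k * Cmod (CDerive_n (t j) n x) <=
        (M * B / Cmod l) * (r / Cmod l) ^ j).
  { intros k n K M r Hr H B HB j x; rewrite Ht; specialize (H j g B HB x).
    assert (Pj : 0 < Cmod l ^ S j) by (apply pow_lt; exact Pl).
    apply Rmult_le_reg_l with (Cmod l ^ S j); [exact Pj|].
    replace (Cmod l ^ S j * (Rabs x ^ k * (/ Cmod l ^ S j *
      Cmod (CDerive_n (Nat.iter j T g) n x)))) with
      (Rabs x ^ k * Cmod (CDerive_n (Nat.iter j T g) n x)) by (field; lra).
    replace (Cmod l ^ S j * (M * B / Cmod l * (r / Cmod l) ^ j)) with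
      (M * r ^ j * B); [exact H|].
    unfold Rdiv; rewrite Rpow_mult_distr, pow_inv; simpl; field.
    split; [apply pow_nonzero|]; lra. }
  assert (Hq : forall r, 0 <= r < Cmod l -> 0 <= r / Cmod l < 1).
  { intros r Hr; split; [apply Rle_mult_inv_pos; lra|].
    apply Rmult_lt_reg_r with (Cmod l); [lra|].
    unfold Rdiv; rewrite Rmult_assoc, Rinv_l; lra. }
  destruct (schwartz_series t) as [F [HF HFb]].
  { intros k n; destruct (HT k n) as [K [M [r [Hr H]]]].
    destruct (schwartz_seminorms_le g K) as [B HB].
    exists (M * B / Cmod l), (r / Cmod l); split; [apply Hq, Hr|].
    apply (Hb k n K M r Hr H B HB). }
  exists F; split.
  - intros x.
    assert (Rec : forall j y, Cmult l (t (S j) y) = t j (phi y)).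
    { intros j y; simpl; field; split; [apply Cpow_nz, Hl | exact Hl]. }
    assert (R0 : Cmult l (t 0%nat x) = Copp (g x)).
    { simpl; field; exact Hl. }
    destruct (HF x) as [A1 A2]; destruct (HF (phi x)) as [B1 B2].
    assert (shift : forall (a : nat -> R) (s : R), is_series a s ->
      is_series (fun j => a (S j)) (s - a 0%nat)).
    { intros a s Ha; apply is_series_incr_1.
      match goal with |- is_series _ ?z => replace z with s end; [exact Ha|].
      unfold plus; simpl; ring. }
    assert (comb : forall (a b : nat -> R) (p q s t : R),
      is_series a s -> is_series b t ->
      is_series (fun j => p * a j + q * b j) (p * s + q * t)).
    { intros a b p q s u Ha Hb'.
      exact (is_series_plus (fun j => p * a j) (fun j => q * b j) (p * s) (q * u)
        (is_series_scal_l p a s Ha) (is_series_scal_l q b u Hb')). }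
    pose proof (comb _ _ (Re l) (- Im l) _ _ (shift _ _ A1) (shift _ _ A2)) as C1.
    pose proof (comb _ _ (Re l) (Im l) _ _ (shift _ _ A2) (shift _ _ A1)) as C2.
    assert (D1 : Re (F (phi x)) = Re l * (Re (F x) - Re (t 0%nat x)) +
      - Im l * (Im (F x) - Im (t 0%nat x))).
    { rewrite <- (is_series_unique _ _ B1), <- (is_series_unique _ _ C1).
      apply Series_ext; intros j; rewrite <- Rec; unfold Re, Im, Cmult; simpl.
      ring. }
    assert (D2 : Im (F (phi x)) = Re l * (Im (F x) - Im (t 0%nat x)) +
      Im l * (Re (F x) - Re (t 0%nat x))).
    { rewrite <- (is_series_unique _ _ B2), <- (is_series_unique _ _ C2).
      apply Series_ext; intros j; rewrite <- Rec; unfold Re, Im, Cmult; simpl.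
      ring. }
    assert (E : F (phi x) = Cmult l (Cminus (F x) (t 0%nat x))).
    { apply injective_projections.
      - change (fst (F (phi x))) with (Re (F (phi x))); rewrite D1.
        unfold Re, Im, Cmult, Cminus, Cplus, Copp; simpl; ring.
      - change (snd (F (phi x))) with (Im (F (phi x))); rewrite D2.
        unfold Re, Im, Cmult, Cminus, Cplus, Copp; simpl; ring. }
    rewrite E; transitivity (Copp (Cmult l (t 0%nat x))); [ring|].
    rewrite R0; ring.
  - intros k n K M r Hr H B HB x.
    pose proof (HFb k n _ _ (Hq r Hr) (Hb k n K M r Hr H B HB) x) as E.
    replace (2 * M / (Cmod l - r) * B) with
      (2 * (M * B / Cmod l) / (1 - r / Cmod l)); [exact E|].
    field; lra.
Qed.

(** Uniqueness of the solution makes the solution operator linear and a two-sided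
    inverse of T - l. *)
Lemma powers_bounded_not_spectrum (phi : R -> R) (hphi : symbol phi) (l : C) :
  l <> RtoC 0 -> powers_bounded (comp_op phi hphi) (Cmod l) ->
  ~ spectrum (comp_op phi hphi) l.
Proof.
  intros Hl HT Hs; apply Hs; clear Hs.
  pose (sol := fun g => constructive_indefinite_description _
    (neumann_solution phi hphi l Hl HT g)).
  pose (S := fun g => proj1_sig (sol g)).
  assert (HS : forall g x, Cminus (S g (phi x)) (Cmult l (S g x)) = g x)
    by (intros g; apply (proj2_sig (sol g))).
  assert (uniq : forall f g : SchwartzSpace,
    (forall x, Cminus (f (phi x)) (Cmult l (f x)) =
               Cminus (g (phi x)) (Cmult l (g x))) -> f = g).
  { intros f g H; apply schwartz_ext; intros x.
    assert (Z : (minus f g : SchwartzSpace) x = RtoC 0).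
    { apply (neumann_injective phi hphi l Hl HT); intros y.
      change (Cminus (f (phi y)) (g (phi y)) = Cmult l (Cminus (f y) (g y))).
      specialize (H y).
      transitivity (Cplus (Cminus (Cminus (f (phi y)) (Cmult l (f y)))
        (Cminus (g (phi y)) (Cmult l (g y)))) (Cmult l (Cminus (f y) (g y))));
        [ring|].
      rewrite H; ring. }
    change (Cminus (f x) (g x) = RtoC 0) in Z.
    transitivity (Cplus (Cminus (f x) (g x)) (g x)); [ring|].
    rewrite Z; ring. }
  assert (Sp : forall f g, S (plus f g) = plus (S f) (S g)).
  { intros f g; apply uniq; intros x; rewrite HS.
    change (Cplus (f x) (g x) = Cminus (Cplus (S f (phi x)) (S g (phi x)))
      (Cmult l (Cplus (S f x) (S g x)))).
    rewrite <- (HS f x), <- (HS g x); ring. }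
  exists S; split; [split; [exact Sp|split]|split].
  - intros c f; apply uniq; intros x; rewrite HS.
    change (Cmult c (f x) = Cminus (Cmult c (S f (phi x)))
      (Cmult l (Cmult c (S f x)))).
    rewrite <- (HS f x); ring.
  - apply seminorm_bounded_continuous; [exact Sp|]; intros k n.
    destruct (HT k n) as [K [M [r [Hr H]]]].
    exists K, (2 * M / (Cmod l - r)); intros g.
    apply (proj2 (proj2_sig (sol g)) k n K M r Hr H).
  - intros f; apply uniq; intros x; rewrite HS; reflexivity.
  - intros g; apply schwartz_ext; intros x; apply HS.
Qed.

(** * Bump functions *)

(** y^-p e^(-1/y) extended by 0.  Carrying the exponent p makes the family closed
    under differentiation up to linear combinations. *)
Definition flat_exp (p : nat) (y : R) : R :=
  if Rle_dec y 0 then 0 else (/ y) ^ p * exp (- / y).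

Lemma flat_exp_nonpos (p : nat) (y : R) : y <= 0 -> flat_exp p y = 0.
Proof. intros H; unfold flat_exp; destruct Rle_dec; [reflexivity | lra]. Qed.

Lemma flat_exp_pos (p : nat) (y : R) : 0 < y -> flat_exp p y = (/ y) ^ p * exp (- / y).
Proof. intros H; unfold flat_exp; destruct Rle_dec; [lra | reflexivity]. Qed.

Lemma exp_INR_mult (n : nat) (x : R) : exp (INR n * x) = exp x ^ n.
Proof.
  induction n as [|n IH]; [simpl; rewrite Rmult_0_l; apply exp_0|].
  rewrite S_INR, Rmult_plus_distr_r, exp_plus, IH, Rmult_1_l; simpl; ring.
Qed.

(** With t = 1 / y this is t^p <= q^p e^t, a consequence of t / q <= e^(t/q); the
    choice q = p + 1 avoids a division by zero when p = 0. *)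
Lemma flat_exp_bounded (p : nat) :
  exists M, 0 < M /\ forall y, Rabs (flat_exp p y) <= M.
Proof.
  set (q := INR (S p)).
  assert (Hq : 0 < q) by (unfold q; apply lt_0_INR; lia).
  exists (q ^ p); split; [apply pow_lt, Hq|]; intros y.
  destruct (Rle_dec y 0) as [Hy|Hy].
  { rewrite flat_exp_nonpos, Rabs_R0 by exact Hy; apply pow_le; lra. }
  apply Rnot_le_lt in Hy; rewrite flat_exp_pos by exact Hy.
  pose proof (Rinv_0_lt_compat _ Hy) as Ht; set (t := / y) in *.
  rewrite Rabs_pos_eq by
    (apply Rmult_le_pos; [apply pow_le; lra | apply Rlt_le, exp_pos]).
  rewrite exp_Ropp; pose proof (exp_pos t).
  apply Rmult_le_reg_r with (exp t); [assumption|].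
  rewrite Rmult_assoc, Rinv_l, Rmult_1_r by lra.
  assert (E : exp t = exp (t / q) ^ S p).
  { rewrite <- exp_INR_mult; f_equal; fold q; field; lra. }
  assert (Htq : 0 < t / q) by (apply Rdiv_lt_0_compat; assumption).
  pose proof (exp_ineq1 (t / q) ltac:(lra)) as X.
  rewrite E; simpl.
  assert (P1 : t ^ p <= q ^ p * exp (t / q) ^ p).
  { rewrite <- Rpow_mult_distr; apply pow_incr; split; [lra|].
    replace t with (q * (t / q)) at 1 by (field; lra).
    apply Rmult_le_compat_l; lra. }
  assert (0 <= exp (t / q) ^ p) by (apply pow_le; lra).
  assert (0 <= q ^ p) by (apply pow_le; lra).
  apply Rle_trans with (q ^ p * exp (t / q) ^ p); [exact P1|].
  apply Rmult_le_compat_l; [assumption|]; nra.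
Qed.

(** At 0 the difference quotient for h > 0 is h times the bounded function with
    exponent p + 2. *)
Lemma flat_exp_derive (p : nat) (y : R) :
  is_derive (flat_exp p) y (flat_exp (S (S p)) y - INR p * flat_exp (S p) y).
Proof.
  destruct (Rtotal_order y 0) as [Hy|[->|Hy]].
  - rewrite !flat_exp_nonpos by lra; rewrite Rmult_0_r, Rminus_0_r.
    apply is_derive_ext_loc with (fun _ => 0).
    + assert (P : 0 < - y) by lra; exists (mkposreal _ P); intros z Hz.
      change (Rabs (z - y) < - y) in Hz; apply Rabs_def2 in Hz.
      symmetry; apply flat_exp_nonpos; lra.
    + apply @is_derive_const.
  - rewrite !flat_exp_nonpos by lra; rewrite Rmult_0_r, Rminus_0_r.
    apply is_derive_Reals; intros e He.
    destruct (flat_exp_bounded (S (S p))) as [M [HM H]].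
    assert (P : 0 < e / M) by (apply Rdiv_lt_0_compat; assumption).
    exists (mkposreal _ P); intros h Hh0 Hh; simpl in Hh.
    rewrite Rplus_0_l, (flat_exp_nonpos p 0), !Rminus_0_r by lra.
    destruct (Rle_dec h 0) as [Hle|Hgt].
    + rewrite flat_exp_nonpos by exact Hle.
      unfold Rdiv; rewrite Rmult_0_l, Rabs_R0; exact He.
    + apply Rnot_le_lt in Hgt; specialize (H h).
      rewrite Rabs_pos_eq in Hh by lra.
      assert (E : flat_exp p h / h = h * flat_exp (S (S p)) h).
      { rewrite !flat_exp_pos by exact Hgt; simpl; field; lra. }
      rewrite E, Rabs_mult, (Rabs_pos_eq h) by lra.
      apply Rle_lt_trans with (h * M); [apply Rmult_le_compat_l; lra|].
      apply Rmult_lt_compat_r with (r := M) in Hh; [|exact HM].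
      replace (e / M * M) with e in Hh by (field; lra); exact Hh.
  - apply is_derive_ext_loc with (fun z => (/ z) ^ p * exp (- / z)).
    + exists (mkposreal _ Hy); intros z Hz.
      change (Rabs (z - y) < y) in Hz; apply Rabs_def2 in Hz.
      symmetry; apply flat_exp_pos; lra.
    + rewrite !flat_exp_pos by exact Hy; auto_derive; [lra|].
      destruct p as [|p]; simpl; field; lra.
Qed.

(** Smooth functions supported in [-1/4, 1/4]: closed under differentiation, which
    yields smoothness of all members at once, and under multiplication by x. *)
Inductive bump_family : (R -> R) -> Prop :=
| bump_base (m p : nat) : bump_family (fun x => x ^ m * flat_exp p (1 / 16 - x ^ 2))
| bump_plus g h : bump_family g -> bump_family h -> bump_family (fun x => g x + h x)
| bump_scal c g : bump_family g -> bump_family (fun x => c * g x).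

Lemma bump_family_derive (g : R -> R) : bump_family g ->
  exists g', bump_family g' /\ forall x, is_derive g x (g' x).
Proof.
  induction 1 as [m p | g h _ [g' [Hg Dg]] _ [h' [Hh Dh]] | c g _ [g' [Hg Dg]]].
  - exists (fun x => INR m * (x ^ pred m * flat_exp p (1 / 16 - x ^ 2)) +
      ((-2) * (x ^ S m * flat_exp (S (S p)) (1 / 16 - x ^ 2)) +
       (2 * INR p) * (x ^ S m * flat_exp (S p) (1 / 16 - x ^ 2)))).
    split.
    + apply bump_plus; [|apply bump_plus]; apply bump_scal; apply bump_base.
    + intros x; pose proof (flat_exp_derive p (1 / 16 - x ^ 2)) as D.
      set (d := flat_exp (S (S p)) (1 / 16 - x ^ 2)) in *.
      set (d1 := flat_exp (S p) (1 / 16 - x ^ 2)) in *.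
      pose proof (is_derive_unique _ _ _ D) as U.
      assert (Ex : ex_derive (flat_exp p) (1 / 16 - x ^ 2)) by (eexists; exact D).
      auto_derive.
      * replace (1 / 16 + - (x * (x * 1))) with (1 / 16 - x ^ 2) by (simpl; ring).
        exact Ex.
      * change (Derive (fun x0 => flat_exp p x0)) with (Derive (flat_exp p)).
        replace (1 / 16 + - (x * (x * 1))) with (1 / 16 - x ^ 2) by (simpl; ring).
        rewrite U; simpl; ring.
  - exists (fun x => g' x + h' x); split; [apply bump_plus; assumption|].
    intros x; exact (is_derive_plus g h x (g' x) (h' x) (Dg x) (Dh x)).
  - exists (fun x => c * g' x); split; [apply bump_scal; assumption|].
    intros x; exact (is_derive_scal g x c (g' x) (Dg x)).
Qed.

Lemma bump_family_Derive_n (g : R -> R) (n : nat) : bump_family g ->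
  exists gn, bump_family gn /\ forall x, Derive_n g n x = gn x.
Proof.
  intros Hg; induction n as [|n [gn [Hn En]]]; [exists g; auto|].
  destruct (bump_family_derive _ Hn) as [g' [Hg' Dg']].
  exists g'; split; [exact Hg'|]; intros x; simpl.
  rewrite (Derive_ext _ gn) by exact En; apply is_derive_unique, Dg'.
Qed.

Lemma bump_family_support (g : R -> R) : bump_family g ->
  forall x, 1 / 4 <= Rabs x -> g x = 0.
Proof.
  induction 1 as [m p | g h _ IHg _ IHh | c g _ IHg]; intros x Hx.
  - rewrite flat_exp_nonpos; [ring|]; rewrite <- pow2_abs; nra.
  - rewrite IHg, IHh by exact Hx; ring.
  - rewrite IHg by exact Hx; ring.
Qed.

Lemma bump_family_bounded (g : R -> R) : bump_family g ->
  exists M, forall x, Rabs (g x) <= M.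
Proof.
  induction 1 as [m p | g h _ [M HM] _ [M' HM'] | c g _ [M HM]].
  - destruct (flat_exp_bounded p) as [M [HM H]]; exists M; intros x.
    destruct (Rle_dec (1 / 4) (Rabs x)) as [Hx|Hx].
    + rewrite (bump_family_support _ (bump_base m p) x Hx), Rabs_R0; lra.
    + rewrite Rabs_mult, <- RPow_abs, <- (Rmult_1_l M).
      apply Rmult_le_compat; [apply pow_le, Rabs_pos | apply Rabs_pos | | apply H].
      rewrite <- (pow1 m); apply pow_incr; split; [apply Rabs_pos | lra].
  - exists (M + M'); intros x; eapply Rle_trans; [apply Rabs_triang|].
    specialize (HM x); specialize (HM' x); lra.
  - exists (Rabs c * M); intros x; rewrite Rabs_mult.
    apply Rmult_le_compat_l; [apply Rabs_pos | apply HM].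
Qed.

Lemma bump_family_rschwartz (g : R -> R) : bump_family g -> rschwartz g.
Proof.
  intros Hg; split.
  - intros [|n] x; [exact I|]; simpl.
    destruct (bump_family_Derive_n g n Hg) as [gn [Hn En]].
    destruct (bump_family_derive _ Hn) as [g' [_ Dg']].
    apply ex_derive_ext with gn; [intros t; symmetry; apply En|].
    exists (g' x); apply Dg'.
  - intros k n; destruct (bump_family_Derive_n g n Hg) as [gn [Hn En]].
    destruct (bump_family_bounded gn Hn) as [M HM].
    exists M; intros x; rewrite En.
    destruct (Rle_dec (1 / 4) (Rabs x)) as [Hx|Hx].
    + rewrite (bump_family_support _ Hn x Hx), Rabs_R0, Rmult_0_r.
      eapply Rle_trans; [apply Rabs_pos | apply (HM 0)].
    + rewrite <- (Rmult_1_l M).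
      apply Rmult_le_compat; [apply pow_le, Rabs_pos | apply Rabs_pos | | apply HM].
      rewrite <- (pow1 k); apply pow_incr; split; [apply Rabs_pos | lra].
Qed.

Lemma bump_family_mult_id (g : R -> R) : bump_family g ->
  bump_family (fun x => x * g x).
Proof.
  induction 1 as [m p | g h _ IHg _ IHh | c g _ IHg].
  - replace (fun x => x * (x ^ m * flat_exp p (1 / 16 - x ^ 2)))
      with (fun x => x ^ S m * flat_exp p (1 / 16 - x ^ 2)); [apply bump_base|].
    apply functional_extensionality; intros x; simpl; ring.
  - replace (fun x => x * (g x + h x)) with (fun x => x * g x + x * h x);
      [apply bump_plus; assumption|].
    apply functional_extensionality; intros x; ring.
  - replace (fun x => x * (c * g x)) with (fun x => c * (x * g x));
      [apply bump_scal; assumption|].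
    apply functional_extensionality; intros x; ring.
Qed.

(** By induction on i, since (x^(i+1) b)' = x^i ((i+1) b + x b'). *)
Lemma monomial_bump_jet (i : nat) : forall b, bump_family b ->
  (forall j, (j < i)%nat -> Derive_n (fun x => x ^ i * b x) j 0 = 0) /\
  Derive_n (fun x => x ^ i * b x) i 0 = INR (Factorial.fact i) * b 0.
Proof.
  induction i as [|i IH]; intros b Hb.
  - split; [intros; lia | simpl; ring].
  - destruct (bump_family_derive b Hb) as [b' [Hb' Db]].
    set (d := fun x => INR (S i) * b x + x * b' x).
    assert (Hd : bump_family d).
    { apply bump_plus; [apply bump_scal, Hb | apply bump_family_mult_id, Hb']. }
    assert (E : forall j, Derive_n (fun x => x ^ S i * b x) (S j) 0 =
      Derive_n (fun x => x ^ i * d x) j 0).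
    { intros j; rewrite Derive_n_shift; apply Derive_n_ext; intros x.
      apply is_derive_unique.
      pose proof (is_derive_unique _ _ _ (Db x)) as U.
      assert (Ex : ex_derive b x) by (eexists; apply Db).
      auto_derive; [exact Ex|].
      change (Derive (fun x0 => b x0) x) with (Derive b x); rewrite U.
      unfold d; change (pred (S i)) with i.
      change (match i with 0%nat => 1 | S _ => INR i + 1 end) with (INR (S i)).
      ring. }
    destruct (IH d Hd) as [I1 I2]; split.
    + intros [|j] Hj; [simpl; ring|]; rewrite E; apply I1; lia.
    + rewrite E, I2; unfold d; rewrite fact_simpl, mult_INR; ring.
Qed.

Lemma rschwartz_zero : rschwartz (fun _ => 0).
Proof. exact (proj1 (proj1 (schwartz_parts _) schwartz_zero)). Qed.

Lemma RtoC_schwartz (u : R -> R) : rschwartz u -> schwartz (fun x => RtoC (u x)).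
Proof.
  intros Hu; apply schwartz_parts; split; [exact Hu | exact rschwartz_zero].
Qed.

Definition monomial_bump (i : nat) (x : R) : R := x ^ i * flat_exp 0 (1 / 16 - x ^ 2).

Lemma monomial_bump_schwartz (i : nat) : schwartz (fun x => RtoC (monomial_bump i x)).
Proof. apply RtoC_schwartz, bump_family_rschwartz, bump_base. Qed.

Lemma bump_at_schwartz (a : R) : schwartz (fun x => RtoC (monomial_bump 0 (1 * x + a))).
Proof. exact (affine_symbol 1 a R1_neq_R0 _ (monomial_bump_schwartz 0)). Qed.

Definition bump_at (a : R) : SchwartzSpace :=
  mkSchwartz (fun x => RtoC (monomial_bump 0 (1 * x + - a))) (bump_at_schwartz (- a)).

Lemma monomial_bump_center : 0 < flat_exp 0 (1 / 16 - 0 ^ 2).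
Proof. rewrite flat_exp_pos by lra; simpl; rewrite Rmult_1_l; apply exp_pos. Qed.

Lemma bump_at_center (a : R) : bump_at a a <> RtoC 0.
Proof.
  simpl; unfold monomial_bump; replace (1 * a + - a) with 0 by ring.
  pose proof monomial_bump_center; intros H0; apply RtoC_inj in H0; simpl in *; lra.
Qed.

Lemma bump_at_outside (a x : R) : 1 / 4 <= Rabs (x - a) -> bump_at a x = RtoC 0.
Proof.
  intros Hx; simpl; f_equal; apply (bump_family_support _ (bump_base 0 0)).
  replace (1 * x + - a) with (x - a) by ring; exact Hx.
Qed.

Lemma bump_at_jet_outside (a x : R) (n : nat) : 1 / 4 <= Rabs (x - a) ->
  CDerive_n (bump_at a) n x = RtoC 0.
Proof.
  intros Hx; unfold CDerive_n, RtoC; f_equal.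
  - simpl; rewrite (Derive_n_comp_affine 1 (- a) (monomial_bump 0)).
    + destruct (bump_family_Derive_n _ n (bump_base 0 0)) as [gn [Hn En]].
      unfold monomial_bump; rewrite En, (bump_family_support _ Hn); [ring|].
      replace (1 * x + - a) with (x - a) by ring; exact Hx.
    + apply (bump_family_rschwartz _ (bump_base 0 0)).
  - simpl; destruct n; [reflexivity | rewrite Derive_n_const; reflexivity].
Qed.

(** * Failure of surjectivity *)

Lemma spectrum_of_not_surjective (phi : R -> R) (hphi : symbol phi) (l : C)
    (g : SchwartzSpace) :
  (forall f : SchwartzSpace,
    ~ forall x, Cminus (f (phi x)) (Cmult l (f x)) = g x) ->
  spectrum (comp_op phi hphi) l.
Proof.
  intros H [S [_ [_ SR]]]; apply (H (S g)); intros x.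
  exact (f_equal (fun h : SchwartzSpace => h x) (SR g)).
Qed.

(** A quadratic takes equal values at v + 1 and v - 1, where v is its vertex, so a
    bump at v + 1 is not in the image. *)
Lemma zero_in_spectrum (b0 b1 b2 : R) (hb2 : b2 <> 0) :
  spectrum (comp_op (quadratic b0 b1 b2) (quadratic_symbol b0 b1 b2 hb2)) (RtoC 0).
Proof.
  set (v := - b1 / (2 * b2)).
  apply (spectrum_of_not_surjective _ _ _ (bump_at (v + 1))); intros f H.
  assert (E : quadratic b0 b1 b2 (v + 1) = quadratic b0 b1 b2 (v - 1)).
  { unfold quadratic, v; field; exact hb2. }
  apply (bump_at_center (v + 1)); rewrite <- (H (v + 1)), E.
  transitivity (bump_at (v + 1) (v - 1)).
  - rewrite <- (H (v - 1)); ring.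
  - apply bump_at_outside; replace (v - 1 - (v + 1)) with (- (2)) by ring.
    rewrite Rabs_Ropp, Rabs_pos_eq; lra.
Qed.

(** On the first nonvanishing derivative at the fixed point, composition acts as
    multiplication by a power of the multiplier th. *)
Lemma jet_at_fixed_point (th : R) (l : C) (f g : SchwartzSpace) (m : nat) :
  (forall x, Cminus (f (quadratic 0 th 1 x)) (Cmult l (f x)) = g x) ->
  (forall i, (i < m)%nat -> CDerive_n f i 0 = RtoC 0) ->
  CDerive_n g m 0 = Cmult (Cminus (RtoC (th ^ m)) l) (CDerive_n f m 0).
Proof.
  intros H H0.
  set (T := comp_op (quadratic 0 th 1) (quadratic_symbol 0 th 1 R1_neq_R0)).
  assert (E : g = plus (T f) (opp (scal l f)) :> SchwartzSpace).
  { apply schwartz_ext; intros x; rewrite <- H; reflexivity. }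
  rewrite E.
  change (sfun (plus (T f) (opp (scal l f)) : SchwartzSpace)) with
    (fun t => Cplus (T f t) ((opp (scal l f) : SchwartzSpace) t)).
  rewrite CDerive_n_plus by apply sfunP.
  change (sfun (opp (scal l f) : SchwartzSpace)) with
    (fun t => Copp ((scal l f : SchwartzSpace) t)).
  rewrite CDerive_n_opp, CDerive_n_scal.
  assert (F : CDerive_n (T f) m 0 = Cmult (RtoC (th ^ m)) (CDerive_n f m 0)).
  { destruct (proj1 (schwartz_parts f) (sfunP f)) as [H1 H2].
    assert (Q : quadratic 0 th 1 0 = 0) by (unfold quadratic; ring).
    assert (Sl : slope th 1 0 = th) by (unfold slope; ring).
    pose proof (Derive_n_comp_quadratic_vanishing 0 th 1 R1_neq_R0 m _ 0 H1) as F1.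
    pose proof (Derive_n_comp_quadratic_vanishing 0 th 1 R1_neq_R0 m _ 0 H2) as F2.
    rewrite Q, Sl in F1, F2.
    unfold CDerive_n; simpl; rewrite F1, F2.
    - unfold RtoC, Cmult; simpl; f_equal; ring.
    - intros i Hi; exact (f_equal snd (H0 i Hi)).
    - intros i Hi; exact (f_equal fst (H0 i Hi)). }
  rewrite F; ring.
Qed.

Lemma vanishing_jet_bound (u : R -> R) (m : nat) : rschwartz u ->
  (forall i, (i < m)%nat -> Derive_n u i 0 = 0) ->
  exists M, forall x, 0 < x -> Rabs (u x) <= M * x ^ m.
Proof.
  intros [Hs Hb] H0; destruct (Hb 0%nat m) as [M HM].
  destruct m as [|m].
  { exists M; intros x _; specialize (HM x); simpl in HM |- *; lra. }
  exists (M / INR (Factorial.fact (S m))); intros x Hx.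
  destruct (Taylor_Lagrange u m 0 x Hx) as [z [_ Ez]];
    [intros; apply Hs|].
  rewrite (sum_eq _ (fun _ => 0) m) in Ez
    by (intros i Hi; rewrite H0 by lia; ring).
  rewrite sum_cte, Rmult_0_l, Rplus_0_l, Rminus_0_r in Ez.
  rewrite Ez, Rabs_mult, (Rabs_pos_eq (x ^ S m / _)).
  - specialize (HM z); rewrite pow_O, Rmult_1_l in HM.
    replace (M / INR (Factorial.fact (S m)) * x ^ S m) with
      (x ^ S m / INR (Factorial.fact (S m)) * M)
      by (field; apply INR_fact_neq_0).
    apply Rmult_le_compat_l; [|exact HM].
    apply Rle_mult_inv_pos; [apply pow_le; lra | apply INR_fact_lt_0].
  - apply Rle_mult_inv_pos; [apply pow_le; lra | apply INR_fact_lt_0].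
Qed.

(** For x >= 2 the orbit at least doubles at each step, so a bound M |x|^-k on f
    with 2^-k < |l| leaves |f (chi^j x)| = |l|^j |f x| no room unless f x = 0. *)
Lemma eigenfunction_vanishes_on_escaping_points (th : R) (l : C) (f : SchwartzSpace) :
  1 <= th -> l <> RtoC 0 ->
  (forall x, 2 <= x -> f (quadratic 0 th 1 x) = Cmult l (f x)) ->
  forall x, 2 <= x -> f x = RtoC 0.
Proof.
  intros Hth Hl H x Hx.
  pose proof (Cmod_gt_0 l) as [Pl _]; specialize (Pl Hl).
  destruct (pow_lt_1_zero (/ 2)) with (y := Cmod l) as [k Hk].
  { rewrite Rabs_pos_eq; lra. }
  { exact Pl. }
  specialize (Hk k (Nat.le_refl k)).
  rewrite Rabs_pos_eq in Hk by (apply pow_le; lra).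
  set (M := seminorm k 0 f).
  apply Cmod_eq_0, (zero_of_geometric_decay _ M ((/ 2) ^ k / Cmod l)).
  { assert (0 < (/ 2) ^ k) by (apply pow_lt; lra).
    split; [apply Rle_mult_inv_pos; lra|].
    apply Rmult_lt_reg_r with (Cmod l); [lra|].
    unfold Rdiv; rewrite Rmult_assoc, Rinv_l; lra. }
  intros j; rewrite (Rabs_pos_eq (Cmod (f x))) by apply Cmod_ge_0.
  set (X := Nat.iter j (quadratic 0 th 1) x).
  assert (HX : 2 ^ S j <= X /\ f X = Cmult (Cpow l j) (f x)).
  { unfold X; induction j as [|j [I1 I2]]; [split; [simpl; lra | simpl; ring]|].
    change (Nat.iter (S j) (quadratic 0 th 1) x) with
      (quadratic 0 th 1 (Nat.iter j (quadratic 0 th 1) x)).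
    set (z := Nat.iter j _ x) in *.
    assert (1 <= 2 ^ j) by (apply pow_R1_Rle; lra).
    assert (Hz : 2 <= z) by (simpl in I1; lra).
    split.
    - change (2 ^ S (S j)) with (2 * 2 ^ S j).
      unfold quadratic; nra.
    - rewrite H by exact Hz; rewrite I2; simpl; ring. }
  destruct HX as [HX1 HX2].
  assert (P2 : 0 < 2 ^ j) by (apply pow_lt; lra).
  assert (HX0 : 2 ^ j <= X) by (simpl in HX1; lra).
  pose proof (seminorm_ub k 0 f (sfunP f) X) as B; fold M in B.
  rewrite CDerive_n_0, HX2, Cmod_mult, Cmod_pow, Rabs_pos_eq in B by lra.
  assert (Pj : 0 < Cmod l ^ j) by (apply pow_lt; exact Pl).
  assert (Pk : 0 < (2 ^ j) ^ k) by (apply pow_lt; exact P2).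
  assert (B' : (2 ^ j) ^ k * (Cmod l ^ j * Cmod (f x)) <= M).
  { eapply Rle_trans; [|exact B]; apply Rmult_le_compat_r.
    - apply Rmult_le_pos; [lra | apply Cmod_ge_0].
    - apply pow_incr; lra. }
  apply Rmult_le_reg_l with ((2 ^ j) ^ k * Cmod l ^ j);
    [apply Rmult_lt_0_compat; assumption|].
  unfold Rdiv; rewrite Rpow_mult_distr, !pow_inv, <- !pow_mult.
  rewrite <- pow_mult in B', Pk; rewrite (Nat.mul_comm j k) in *.
  replace (2 ^ (k * j) * Cmod l ^ j * (M * (/ 2 ^ (k * j) * / Cmod l ^ j)))
    with M by (field; lra).
  lra.
Qed.

(** The positive solution s of s (th + s) = y. *)
Definition preimage (th y : R) : R := (sqrt (th ^ 2 + 4 * y) - th) / 2.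

Lemma preimage_spec (th y : R) : 1 <= th -> 0 < y ->
  0 < preimage th y /\ preimage th y * (th + preimage th y) = y.
Proof.
  intros Hth Hy; unfold preimage.
  assert (S0 : 0 <= th ^ 2 + 4 * y) by nra.
  pose proof (sqrt_sqrt _ S0) as S2; pose proof (sqrt_pos (th ^ 2 + 4 * y)).
  set (s := sqrt _) in *.
  assert (th < s) by nra.
  split; nra.
Qed.

(** The backward orbit of 1 under x |-> th x + x^2. *)
Definition backward (th : R) (n : nat) : R := Nat.iter n (preimage th) 1.

Lemma backward_pos (th : R) (n : nat) : 1 <= th -> 0 < backward th n.
Proof.
  intros Hth; induction n as [|n IH]; [simpl; lra|].
  exact (proj1 (preimage_spec th _ Hth IH)).
Qed.

Lemma backward_step (th : R) (n : nat) : 1 <= th ->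
  backward th (S n) * (th + backward th (S n)) = backward th n.
Proof.
  intros Hth; exact (proj2 (preimage_spec th _ Hth (backward_pos th n Hth))).
Qed.

(** Keeps the orbit, from its second point on, away from the support of a bump at
    1. *)
Lemma backward_le (th : R) (n : nat) : 1 <= th -> backward th (S n) <= 3 / 4.
Proof.
  intros Hth; induction n as [|n IH].
  - pose proof (backward_step th 0 Hth); pose proof (backward_pos th 1 Hth).
    change (backward th 0) with 1 in *; nra.
  - pose proof (backward_step th (S n) Hth).
    pose proof (backward_pos th (S (S n)) Hth); nra.
Qed.

Lemma backward_geometric (th : R) (n : nat) : 1 <= th ->
  backward th n <= (/ th) ^ n.
Proof.
  intros Hth; induction n as [|n IH]; [simpl; unfold backward; simpl; lra|].
  pose proof (backward_step th n Hth); pose proof (backward_pos th (S n) Hth).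
  apply Rmult_le_reg_l with th; [lra|].
  change ((/ th) ^ S n) with (/ th * (/ th) ^ n).
  rewrite <- (Rmult_assoc th), Rinv_r, Rmult_1_l by lra; nra.
Qed.

(** When th = 1 the convergence to 0 is only harmonic: z (1 + z) <= 2 / (n + 1)
    forces z <= 2 / (n + 2). *)
Lemma backward_parabolic (n : nat) : backward 1 n <= 2 / INR (S n).
Proof.
  induction n as [|n IH]; [simpl; unfold backward; simpl; lra|].
  pose proof (backward_step 1 n ltac:(lra)) as E.
  pose proof (backward_pos 1 (S n) ltac:(lra)) as P.
  set (z := backward 1 (S n)) in *; rewrite <- E in IH.
  rewrite !S_INR in *; pose proof (pos_INR n) as N; set (k := INR n) in *.
  destruct (Rle_dec z (2 / (k + 1 + 1))) as [Hz|Hz]; [exact Hz|exfalso].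
  apply Rnot_le_lt in Hz; set (w := 2 / (k + 1 + 1)) in *.
  assert (W : w * (k + 1 + 1) = 2) by (unfold w; field; lra).
  apply Rmult_le_compat_r with (r := k + 1) in IH; [|lra].
  replace (2 / (k + 1) * (k + 1)) with 2 in IH by (field; lra).
  assert (w * (1 + w) < z * (1 + z)) by (assert (0 < w) by nra; nra).
  assert (w * (1 + w) * (k + 1) >= 2); [|nra].
  assert (Hw : 0 < w) by nra.
  assert (w * (k + 1) = 2 - w) by nra.
  assert (w <= 1) by nra.
  nra.
Qed.

Lemma least_power (th : R) (l : C) (m : nat) :
  (forall j, (j < m)%nat -> l <> RtoC (th ^ j)) \/
  exists i, l = RtoC (th ^ i) /\ forall j, (j < i)%nat -> l <> RtoC (th ^ j).
Proof.
  induction m as [|m [IH|IH]]; [left; intros; lia | | right; exact IH].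
  destruct (excluded_middle_informative (l = RtoC (th ^ m))) as [E|E].
  - right; exists m; split; assumption.
  - left; intros j Hj; destruct (Nat.eq_dec j m) as [->|Hn]; [exact E|].
    apply IH; lia.
Qed.

Lemma vanishing_jet (th : R) (l : C) (f g : SchwartzSpace) (m : nat) :
  (forall x, Cminus (f (quadratic 0 th 1 x)) (Cmult l (f x)) = g x) ->
  (forall j, (j < m)%nat -> l <> RtoC (th ^ j)) ->
  (forall j, (j < m)%nat -> CDerive_n g j 0 = RtoC 0) ->
  forall j, (j < m)%nat -> CDerive_n f j 0 = RtoC 0.
Proof.
  intros H Hl Hg j; induction j as [j IH] using Wf_nat.lt_wf_ind; intros Hj.
  pose proof (jet_at_fixed_point th l f g j H) as E.
  rewrite (Hg j Hj) in E; specialize (E ltac:(intros; apply IH; lia)).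
  destruct (excluded_middle_informative (CDerive_n f j 0 = RtoC 0)) as [Z|Z];
    [exact Z | exfalso].
  apply (Cmult_neq_0 (Cminus (RtoC (th ^ j)) l) (CDerive_n f j 0));
    [|exact Z | symmetry; exact E].
  intros D; apply (Hl j Hj).
  transitivity (Cminus (RtoC (th ^ j)) (Cminus (RtoC (th ^ j)) l)); [ring|].
  rewrite D; ring.
Qed.

(** The hypothesis says that |l|^n y_n^m comes arbitrarily close to 0 along the
    backward orbit y_n of 1.  If l avoids th^j for j < m, the solution f for a bump
    at 1 vanishes to order m at the fixed point; otherwise let i be minimal with
    th^i = l: the i-th derivative at the fixed point is the obstruction. *)
Lemma repelling_spectrum (th : R) (l : C) (m : nat) :
  1 <= th -> l <> RtoC 0 ->
  (forall e, 0 < e -> exists n, Cmod l ^ n * backward th n ^ m < e) ->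
  spectrum (comp_op (quadratic 0 th 1) (quadratic_symbol 0 th 1 R1_neq_R0)) l.
Proof.
  intros Hth Hl Hm.
  destruct (least_power th l m) as [Hp|[i [Hi Hp]]].
  - apply (spectrum_of_not_surjective _ _ _ (bump_at 1)); intros f H.
    assert (J : forall j, (j < m)%nat -> CDerive_n f j 0 = RtoC 0).
    { apply (vanishing_jet th l f (bump_at 1) m H Hp).
      intros j _; apply bump_at_jet_outside.
      rewrite Rminus_0_l, Rabs_Ropp, Rabs_R1; lra. }
    assert (B : exists M, 0 < M /\ forall x, 0 < x -> Cmod (f x) <= M * x ^ m).
    { destruct (proj1 (schwartz_parts f) (sfunP f)) as [H1 H2].
      destruct (vanishing_jet_bound _ m H1) as [M1 B1];
        [intros i Hi; exact (f_equal fst (J i Hi))|].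
      destruct (vanishing_jet_bound _ m H2) as [M2 B2];
        [intros i Hi; exact (f_equal snd (J i Hi))|].
      exists (Rmax 1 (M1 + M2)); split; [pose proof (Rmax_l 1 (M1 + M2)); lra|].
      intros x Hx; pose proof (Rmax_r 1 (M1 + M2)).
      specialize (B1 x Hx); specialize (B2 x Hx).
      pose proof (pow_lt x m Hx).
      eapply Rle_trans; [apply Cmod_le_abs|]; unfold Re, Im in B1, B2; nra. }
    destruct B as [M [HM B]].
    assert (Hstep : forall x, 1 / 4 <= Rabs (x - 1) ->
      f (quadratic 0 th 1 x) = Cmult l (f x)).
    { intros x Hx; pose proof (H x) as E; rewrite bump_at_outside in E by exact Hx.
      transitivity (Cplus (Cminus (f (quadratic 0 th 1 x)) (Cmult l (f x)))
        (Cmult l (f x))); [ring|].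
      rewrite E; ring. }
    (* The forward orbit of 1 lies in [2, +oo), where f vanishes, so that the
       equation at 1 reads - l f 1 = g 1. *)
    assert (F1 : f 1 <> RtoC 0).
    { intros F; apply (bump_at_center 1); rewrite <- (H 1), F.
      rewrite (eigenfunction_vanishes_on_escaping_points th l f Hth Hl);
        [ring | |unfold quadratic; nra].
      intros x Hx; apply Hstep; rewrite Rabs_pos_eq; lra. }
    assert (Fn : forall n, f 1 = Cmult (Cpow l n) (f (backward th n))).
    { induction n as [|n IH]; [simpl; change (backward th 0) with 1; ring|].
      rewrite IH; pose proof (backward_step th n Hth) as E.
      pose proof (backward_le th n Hth).
      replace (backward th n) with (quadratic 0 th 1 (backward th (S n)))
        by (unfold quadratic; rewrite <- E; ring).
      rewrite Hstep; [simpl; ring|].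
      rewrite Rabs_minus_sym, Rabs_pos_eq; lra. }
    pose proof (Cmod_gt_0 (f 1)) as [P1 _]; specialize (P1 F1).
    destruct (Hm (Cmod (f 1) / M)) as [n Hn];
      [apply Rdiv_lt_0_compat; assumption|].
    pose proof (B _ (backward_pos th n Hth)) as Bn.
    assert (E : Cmod (f 1) <= Cmod l ^ n * (M * backward th n ^ m)).
    { rewrite (Fn n) at 1; rewrite Cmod_mult, Cmod_pow.
      apply Rmult_le_compat_l; [apply pow_le, Cmod_ge_0 | exact Bn]. }
    apply Rmult_lt_compat_l with (r := M) in Hn; [|exact HM].
    replace (M * (Cmod (f 1) / M)) with (Cmod (f 1)) in Hn by (field; lra).
    lra.
  - apply (spectrum_of_not_surjective _ _ _
      (mkSchwartz _ (monomial_bump_schwartz i))); intros f H.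
    set (g := mkSchwartz _ (monomial_bump_schwartz i)) in H.
    destruct (monomial_bump_jet i _ (bump_base 0 0)) as [J0 J1].
    assert (Eg : forall j, CDerive_n g j 0 = RtoC
      (Derive_n (fun x => x ^ i * (x ^ 0 * flat_exp 0 (1 / 16 - x ^ 2))) j 0)).
    { intros j; unfold CDerive_n, RtoC; f_equal.
      - apply Derive_n_ext; intros t; rewrite pow_O, Rmult_1_l; reflexivity.
      - simpl; destruct j; [reflexivity | rewrite Derive_n_const; reflexivity]. }
    pose proof (jet_at_fixed_point th l f g i H) as E.
    rewrite Eg, J1 in E.
    assert (Z : INR (Factorial.fact i) * (0 ^ 0 * flat_exp 0 (1 / 16 - 0 ^ 2)) <> 0).
    { pose proof monomial_bump_center; rewrite pow_O, Rmult_1_l.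
      apply Rmult_integral_contrapositive_currified;
        [apply INR_fact_neq_0 | lra]. }
    apply Z, RtoC_inj; rewrite E.
    + rewrite Hi; ring.
    + apply (vanishing_jet th l f g i H Hp).
      intros j Hj; rewrite Eg, J0 by exact Hj; reflexivity.
Qed.

(** The condition on th says that th / 2 is a fixed point of x^2 + c, and
    x |-> (x + th / 2 - a1 / 2) / a2 sends 0 to the corresponding fixed point of the
    given quadratic. *)
Lemma fixed_point_conjugacy (a0 a1 a2 : R) (ha2 : a2 <> 0) (th : R) :
  (th - 1) ^ 2 = 1 - 4 * (a0 * a2 + a1 / 2 - a1 ^ 2 / 4) ->
  forall l,
  spectrum (comp_op (quadratic 0 th 1) (quadratic_symbol 0 th 1 R1_neq_R0)) l ->
  spectrum (comp_op (quadratic a0 a1 a2) (quadratic_symbol a0 a1 a2 ha2)) l.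
Proof.
  intros Hth l; apply (spectrum_conj _ _ _ _ (/ a2) ((th / 2 - a1 / 2) / a2)).
  - apply Rinv_neq_0_compat, ha2.
  - intros x.
    assert (E : a0 = ((1 - (th - 1) ^ 2) / 4 - a1 / 2 + a1 ^ 2 / 4) / a2)
      by (rewrite Hth; field; exact ha2).
    rewrite E; unfold quadratic; field; exact ha2.
Qed.

Lemma centred_conjugacy (a0 a1 a2 : R) (ha2 : a2 <> 0) (l : C) :
  spectrum (comp_op (quadratic a0 a1 a2) (quadratic_symbol a0 a1 a2 ha2)) l ->
  spectrum (comp_op (quadratic (a0 * a2 + a1 / 2 - a1 ^ 2 / 4) 0 1)
    (quadratic_symbol _ 0 1 R1_neq_R0)) l.
Proof.
  apply (spectrum_conj _ _ _ _ a2 (a1 / 2) ha2).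
  intros x; unfold quadratic; field.
Qed.

Theorem theorem3p4 (a0 a1 a2 : R) (ha2 : a2 <> 0) :
  let C_phi := comp_op (quadratic a0 a1 a2) (quadratic_symbol a0 a1 a2 ha2) in
  let c := a0 * a2 + a1 / 2 - a1 ^ 2 / 4 in
  (c > 1 / 4 -> forall l : C, spectrum C_phi l <-> l = RtoC 0) /\
  (c = 1 / 4 -> forall l : C, spectrum C_phi l <-> Cmod l <= 1) /\
  (c < 1 / 4 -> forall l : C, spectrum C_phi l).
Proof.
  intros C_phi c; split; [|split].
  - intros Hc l; split; [|intros ->; apply zero_in_spectrum].
    intros Hs; apply centred_conjugacy in Hs; fold c in Hs.
    destruct (excluded_middle_informative (l = RtoC 0)) as [E|Hl]; [exact E|].
    exfalso; revert Hs; apply powers_bounded_not_spectrum; [exact Hl|].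
    apply weight_powers_bounded, weight_no_fixed_point; [exact Hc|].
    apply Cmod_gt_0, Hl.
  - intros Hc l; split.
    + intros Hs; apply centred_conjugacy in Hs; fold c in Hs.
      destruct (Rle_dec (Cmod l) 1) as [Hl|Hl]; [exact Hl|].
      apply Rnot_le_lt in Hl; exfalso; revert Hs.
      apply powers_bounded_not_spectrum.
      * intros ->; rewrite Cmod_0 in Hl; lra.
      * apply weight_powers_bounded; rewrite Hc.
        apply weight_parabolic, Hl.
    + intros Hl.
      destruct (excluded_middle_informative (l = RtoC 0)) as [->|Hl0];
        [apply zero_in_spectrum|].
      apply (fixed_point_conjugacy a0 a1 a2 ha2 1); [fold c; lra|].
      apply (repelling_spectrum 1 l 1); [lra | exact Hl0|].
      intros e He; destruct (archimed_cor1 (e / 2)) as [n [Hn Pn]]; [lra|].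
      exists n; rewrite pow_1.
      pose proof (backward_parabolic n) as Bn.
      pose proof (backward_pos 1 n ltac:(lra)) as Bp.
      apply Rle_lt_trans with (1 * (2 / INR (S n))).
      * apply Rmult_le_compat; try lra; [apply pow_le, Cmod_ge_0|].
        rewrite <- (pow1 n); apply pow_incr; split; [apply Cmod_ge_0 | exact Hl].
      * assert (0 < INR n) by (apply lt_0_INR, Pn).
        assert (/ INR (S n) < / INR n).
        { apply Rinv_lt_contravar; [apply Rmult_lt_0_compat|];
            rewrite ?S_INR; lra. }
        unfold Rdiv; lra.
  - intros Hc l.
    destruct (excluded_middle_informative (l = RtoC 0)) as [->|Hl0];
      [apply zero_in_spectrum|].
    assert (S0 : 0 < 1 - 4 * c) by lra.
    pose proof (sqrt_lt_R0 _ S0) as Ps.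
    set (th := 1 + sqrt (1 - 4 * c)).
    apply (fixed_point_conjugacy a0 a1 a2 ha2 th).
    { fold c; unfold th; replace (1 + sqrt (1 - 4 * c) - 1) with
        (sqrt (1 - 4 * c)) by ring.
      apply pow2_sqrt; lra. }
    destruct (Pow_x_infinity th) with (b := Cmod l + 1) as [m Hm].
    { rewrite Rabs_pos_eq; unfold th; lra. }
    specialize (Hm m (Nat.le_refl m)).
    rewrite Rabs_pos_eq in Hm by (apply pow_le; unfold th; lra).
    apply (repelling_spectrum th l m); [unfold th; lra | exact Hl0|].
    intros e He.
    assert (Pt : 0 < th ^ m) by (apply pow_lt; unfold th; lra).
    pose proof (Cmod_ge_0 l) as Pl.
    destruct (pow_lt_1_zero (Cmod l / th ^ m)) with (y := e) as [n Hn].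
    { rewrite Rabs_pos_eq by (apply Rle_mult_inv_pos; lra).
      apply Rmult_lt_reg_r with (th ^ m); [exact Pt|].
      unfold Rdiv; rewrite Rmult_assoc, Rinv_l; lra. }
    { exact He. }
    exists n; specialize (Hn n (Nat.le_refl n)).
    rewrite Rabs_pos_eq in Hn by (apply pow_le, Rle_mult_inv_pos; lra).
    eapply Rle_lt_trans; [|exact Hn].
    unfold Rdiv; rewrite Rpow_mult_distr; apply Rmult_le_compat_l.
    { apply pow_le, Pl. }
    pose proof (backward_geometric th n ltac:(unfold th; lra)) as Bn.
    pose proof (backward_pos th n ltac:(unfold th; lra)) as Bp.
    rewrite pow_inv, <- pow_mult, (Nat.mul_comm m n), pow_mult, <- pow_inv.
    rewrite <- pow_inv; apply pow_incr; lra.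
Qed.
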